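(* Let $G$ be a finite rectangular grid with toroidal boundary conditions on $n$ vertices, let $\Theta=\{\Theta_1,\dots,\Theta_m\}$ be a cover of its vertex set by $2\times 2$ sub-grids with $m$ smallest possible, listed in an arbitrary order, and let $\mathcal{M}_{\mathrm{grid}}$ be the systematic scan Markov chain on the set $\Omega^{+}$ of all $7$-colourings of $G$ whose transition matrix is $P_{\mathrm{grid}}=\prod_{k=1}^{m}P^{[k]}$, where $P^{[k]}$ is the heat-bath update of the block $\Theta_k$. Then for every $\epsilon\in(0,1)$ the mixing time of $\mathcal{M}_{\mathrm{grid}}$ to the uniform distribution $\pi$ on proper $7$-colourings of $G$ satisfies $$\mathrm{Mix}(\mathcal{M}_{\mathrm{grid}},\epsilon)\le 63\log(n\epsilon^{-1}).$$
   Context: Grid: for integers $a,b\ge 2$, $G$ has vertex set $V=\mathbb{Z}_a\times\mathbb{Z}_b$, $n=|V|=ab$, and $(x,y)$ is adjacent to $(x\pm1,y)$ and $(x,y\pm1)$ (coordinates mod $a$ and mod $b$); $G$ is regarded as a simple graph. A $2\times2$ sub-grid (block) is a set $\{x,x+1\}\times\{y,y+1\}$. Colourings: $Q=\{1,\dots,7\}$. A colouring is any function $\sigma:V\to Q$ (not necessarily proper); $\Omega^{+}$ is the set of all colourings, $\Omega\subseteq\Omega^{+}$ the set of proper ones (adjacent vertices get different colours), and $\pi$ is the uniform distribution on $\Omega$ (regarded as a distribution on $\Omega^{+}$). Blocks: $\Theta=\{\Theta_1,\dots,\Theta_m\}$ is a set of $2\times 2$ sub-grids with $\bigcup_{k=1}^m\Theta_k=V$,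 where $m$ is the smallest integer for which such a cover exists; the order of the blocks is arbitrary. $\partial\Theta_k$ is the set of vertices in $V\setminus\Theta_k$ adjacent to some vertex of $\Theta_k$. Heat-bath: for $\sigma\in\Omega^{+}$ let $\Omega_k(\sigma)$ be the set of $\sigma'\in\Omega^{+}$ such that $\sigma'=\sigma$ on $V\setminus\Theta_k$, adjacent vertices inside $\Theta_k$ get different colours under $\sigma'$, and each $j\in\Theta_k$ has $\sigma'_j$ different from the colours under $\sigma$ of all vertices of $\partial\Theta_k$ adjacent to $j$. Let $\pi_k(\sigma)$ be the uniform distribution on $\Omega_k(\sigma)$. $P^{[k]}$ is the transition matrix on $\Omega^{+}$ with $P^{[k]}(\sigma,\cdot)=\pi_k(\sigma)$. Mixing time: for a Markov chain $\mathcal{M}$ with state space $\Omega^{+}$, transition matrix $P$ and stationary distribution $\pi$, $$\mathrm{Mix}(\mathcal{M},\epsilon)=\max_{\sigma\in\Omega^{+}}\min\{t>0: d_{\mathrm{TV}}(P^t(\sigma,\cdot),\pi)\le\epsilon\},\qquad d_{\mathrm{TV}}(\theta_1,\theta_2)=\tfrac12\sum_{i}|\theta_1(i)-\theta_2(i)|,$$ with $t$ ranging over positive integers. $\log$ is the natural logarithm. *)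

(* Defs.v *)
From HB Require Import structures.
From mathcomp Require Import all_boot all_order all_algebra.
From mathcomp Require Import all_classical all_reals all_analysis.

Set Implicit Arguments.
Unset Strict Implicit.
Unset Printing Implicit Defensive.

Import Order.TTheory GRing.Theory Num.Theory.

Local Open Scope ring_scope.

Definition uniform_dist (R : realType) (T : finType) (A : {set T}) (x : T) : R :=
  (x \in A)%:R / #|A|%:R.

Definition dTV (R : realType) (T : finType) (p q : T -> R) : R :=
  2^-1 * \sum_(x : T) `|p x - q x|.

(* Matrices on a finite type [T] are indexed through [enum_rank]/[enum_val]. *)
Definition markov_row (R : realType) (T : finType) (P : 'M[R]_#|T|) (s : T) :
  T -> R := fun x => P (enum_rank s) (enum_rank x).

(* The infimum is the minimum when some [t] qualifies, and [+oo] otherwise, so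
   that a finite upper bound entails that the minimum exists for every start. *)
Definition mixing_time_from (R : realType) (T : finType) (P : 'M[R]_#|T|)
    (pi : T -> R) (eps : R) (s : T) : \bar R :=
  ereal_inf [set (t%:R)%:E | t in
    [set t : nat | (0 < t)%N /\ dTV (markov_row (P ^+ t) s) pi <= eps]]%classic.

Definition mixing_time (R : realType) (T : finType) (P : 'M[R]_#|T|)
    (pi : T -> R) (eps : R) : \bar R :=
  \big[maxe/-oo%E]_(s : T) mixing_time_from P pi eps s.

Definition colouring (V : finType) := {ffun V -> 'I_7}.

Definition proper_colourings (V : finType) (e : rel V) : {set colouring V} :=
  [set s : colouring V | [forall u, forall v, e u v ==> (s u != s v)]].

Definition block_boundary (V : finType) (e : rel V) (B : {set V}) : {set V} :=
  [set v | (v \notin B) && [exists u in B, e v u]].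

Definition heat_bath_set (V : finType) (e : rel V) (B : {set V})
    (s : colouring V) : {set colouring V} :=
  [set s' : colouring V |
    [&& [forall v, (v \notin B) ==> (s' v == s v)],
        [forall u in B, forall v in B, e u v ==> (s' u != s' v)] &
        [forall u in B, forall v in block_boundary e B,
           e u v ==> (s' u != s v)]]].

Definition block_update (R : realType) (V : finType) (e : rel V)
    (B : {set V}) : 'M[R]_#|colouring V| :=
  \matrix_(i, j) uniform_dist R (heat_bath_set e B (enum_val i)) (enum_val j).

(* The product is the (ordered) matrix product: since the rows are the
   transition probabilities, the first block of the list is updated first. *)
Definition systematic_scan (R : realType) (V : finType) (e : rel V)
    (Theta : seq {set V}) : 'M[R]_#|colouring V| :=
  \prod_(B <- Theta) block_update R e B.

(* ['Z_a] is the ring of integers mod [a] only if [1 < a]. *)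
Definition grid (a b : nat) := ('Z_a * 'Z_b)%type.

(* When [a = 2] (or [b = 2]) two of the listed neighbours coincide, and there is
   only one edge since [grid_adj] is a relation. *)
Definition grid_adj (a b : nat) : rel (grid a b) := fun u v =>
  v \in [:: (u.1 + 1, u.2); (u.1 - 1, u.2); (u.1, u.2 + 1); (u.1, u.2 - 1)].

Definition block22 (a b : nat) (x : 'Z_a) (y : 'Z_b) : {set grid a b} :=
  finset.setX [set x; x + 1] [set y; y + 1].

Definition block_cover (a b : nat) (S : {set {set grid a b}}) : Prop :=
  (forall B, B \in S -> exists x y, B = block22 x y) /\
  finset.cover S = [set: grid a b].

Definition min_block_cover (a b : nat) (S : {set {set grid a b}}) : Prop :=
  block_cover S /\
  (forall S' : {set {set grid a b}}, block_cover S' -> (#|S| <= #|S'|)%N).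

(* Main.v *)
(** Let v0, v1, v2, v3 be the corners of a block in cyclic order, and let L_i be the set of
    colours that the boundary allows at v_i, so that |L_i| >= 5. Changing the colour of one
    boundary vertex next to v0 exchanges at most one colour of L0. The heat-bath average of a
    function f is the average over x in L0 of F(x), weighted by the number N(x) of ways to
    colour v1, v2, v3 given the colour x at v0; so the exchange of c moves it by at most
    theta * max_x |F(c) - F(x)|, where theta is the share of c in the total weight. To compare
    F(c) with F(x), reveal v2 first: its laws given c and given x are at total variation
    distance kappa, and once v0 and v2 are known v1 and v3 are independent and uniform on lists
    that change by one colour, which costs at most tau on average. The numbers theta, kappa and
    tau depend only on how many colours have each membership pattern in (L1, L2, L3), and a
    finite enumeration bounds them. The influence of the boundary vertex on the corners at
    distance 0, 1, 1, 2 from v0 comes out as 0.283, 0.0865, 0.0865, 0.034.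

    Measure f by its oscillation at each vertex. A corner has at most two neighbours outside the
    block, so a block update replaces oscillation at a corner by at most
    2 (0.283 + 2 * 0.0865 + 0.034) = 49/50 times as much outside the block. As the blocks cover
    the grid, a scan multiplies the total oscillation by at most 49/50, and the distance to the
    stationary distribution after t scans is at most n (49/50)^t. *)

Require Import Defs.
From Stdlib Require Import PeanoNat BinNat Nnat.
From HB Require Import structures.
From mathcomp Require Import all_boot all_order all_algebra ring lra.

Set Implicit Arguments.
Unset Strict Implicit.
Unset Printing Implicit Defensive.

Import Order.TTheory GRing.Theory Num.Theory.

(** * Colour counts on a path of three vertices *)

(* The membership pattern of a colour in the three lists (L1, L2, L3). *)
Local Notation typ := (bool * bool * bool)%type.

Definition types : seq typ :=
  [:: (true, true, true); (true, true, false); (true, false, true); (true, false, false);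
      (false, true, true); (false, true, false); (false, false, true); (false, false, false)].

(** Binary naturals keep the arithmetic of the enumeration fast under [vm_compute]. *)
Definition b2N (b : bool) : N := if b then 1%num else 0%num.

Definition sumN (T : Type) (f : T -> N) (s : seq T) : N :=
  foldr (fun t acc => N.add (f t) acc) 0%num s.

(* Here [l1] and [l3] are the sizes of [L1] and [L3], and [z] is a colour different from [x];
   [diag_weightN] is the case [z = x]. *)
Definition weightN (l1 l3 : N) (x z : typ) : N :=
  if z.1.2 then N.mul (N.sub (N.sub l1 (b2N x.1.1)) (b2N z.1.1))
                      (N.sub (N.sub l3 (b2N x.2)) (b2N z.2))
  else 0%num.

Definition diag_weightN (l1 l3 : N) (x : typ) : N :=
  if x.1.2 then N.mul (N.sub l1 (b2N x.1.1)) (N.sub l3 (b2N x.2)) else 0%num.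

(** Five of seven colours present means at most two absent. Counting absences makes the condition
    pass to sublists, so it prunes the choices of [r] before the distinguished colours are
    picked. *)
Definition few_missing (s : seq typ) : bool :=
  [&& (count (fun t => ~~ t.1.1) s <= 2)%N, (count (fun t => ~~ t.1.2) s <= 2)%N
    & (count (fun t => ~~ t.2) s <= 2)%N].

(* Bounds in thousandths, found by enumeration; the second case is the one where the exchanged
   colour belongs to neither [L1] nor [L3]. *)
Definition theta1000 (c1 c3 : bool) : N := if c1 || c3 then 246%num else 283%num.

Definition kappa1000 (c1 c3 : bool) : N := if c1 || c3 then 135%num else 112%num.

(* [D] compensates in [NA] for counting each colour of [r] against itself. *)
Definition theta_check (c e1 e2 : typ) (r : seq typ) : bool :=
  let s := [:: c, e1, e2 & r] in
  few_missing s ==>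
  let l1 := sumN (fun t => b2N t.1.1) s in
  let l3 := sumN (fun t => b2N t.2) s in
  let Nc := N.add (diag_weightN l1 l3 c) (sumN (weightN l1 l3 c) [:: e1, e2 & r]) in
  let NA := sumN (fun x => N.add (diag_weightN l1 l3 x) (sumN (weightN l1 l3 x) s)) r in
  let D := sumN (fun x => weightN l1 l3 x x) r in
  let th := theta1000 c.1.1 c.2 in
  N.leb (N.add (N.mul 1000 Nc) (N.mul th D)) (N.mul th (N.add NA Nc)).

(** Total variation distance of the laws of v2 given c and given x, cleared of denominators.
    Truncated subtraction in [gap] takes the positive parts, and [r] holds the five other
    colours. *)
Definition kappa_check (c x : typ) (r : seq typ) : bool :=
  let s := [:: c, x & r] in
  few_missing s ==>
  let l1 := sumN (fun t => b2N t.1.1) s in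
  let l3 := sumN (fun t => b2N t.2) s in
  let Nc := N.add (diag_weightN l1 l3 c) (sumN (weightN l1 l3 c) (x :: r)) in
  let Nx := N.add (diag_weightN l1 l3 x) (sumN (weightN l1 l3 x) (c :: r)) in
  let gap p q := N.sub (N.mul p Nx) (N.mul q Nc) in
  let lhs := N.add (N.add (gap (diag_weightN l1 l3 c) (weightN l1 l3 x c))
                          (gap (weightN l1 l3 c x) (diag_weightN l1 l3 x)))
                   (sumN (fun t => gap (weightN l1 l3 c t) (weightN l1 l3 x t)) r) in
  N.leb (N.mul 1000 lhs) (N.mul (kappa1000 c.1.1 c.2) (N.mul Nx Nc)).

(* [coefN m / 12] bounds [1 / (m + 1)] for [m >= 2], and [3612 = 12 * 301]. *)
Definition coefN (m : N) : N := if N.leb m 2 then 4%num else 3%num.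

(** Bounds the mean of 1 / (|L1 \ {c, x, z}| + 1) when z follows the law of v2 given x. [B] is |L1 \
    {c, x}|, from which z in {c, x} removes nothing more. *)
Definition tau_check (c x : typ) (r : seq typ) : bool :=
  let s := [:: c, x & r] in
  few_missing s ==>
  let l1 := sumN (fun t => b2N t.1.1) s in
  let l3 := sumN (fun t => b2N t.2) s in
  let Nx := N.add (diag_weightN l1 l3 x) (sumN (weightN l1 l3 x) (c :: r)) in
  let B := N.sub (N.sub l1 (b2N x.1.1)) (b2N c.1.1) in
  let lhs := N.add (N.mul (coefN B) (N.add (diag_weightN l1 l3 x) (weightN l1 l3 x c)))
    (sumN (fun t => N.mul (coefN (N.sub B (b2N t.1.1))) (weightN l1 l3 x t)) r) in
  N.leb (N.mul 1000 lhs) (N.mul 3612 Nx).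

(** The checks ignore the order of [r], so one ordering of each multiset suffices: 792 lists of five
    patterns instead of 8^5. *)
Fixpoint multisets (T : Type) (ts : seq T) (k : nat) : seq (seq T) :=
  if ts is t :: ts' then
    flatten [seq [seq nseq j t ++ r | r <- multisets ts' (k - j)] | j <- iota 0 k.+1]
  else if k == 0 then [:: [::]] else [::].

Definition theta_checks :=
  all (fun r => few_missing r ==> all (fun c => all (fun e1 => all (fun e2 =>
    theta_check c e1 e2 r) types) types) types) (multisets types 4).

Definition pair_checks :=
  all (fun r => few_missing r ==> all (fun c => all (fun x =>
    kappa_check c x r && tau_check c x r) types) types) (multisets types 5).

Lemma theta_checks_true : theta_checks. Proof. by vm_compute. Qed.

Lemma pair_checks_true : pair_checks. Proof. by vm_compute. Qed.

(** * Transfer of the enumerated checks to natural numbers *)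

Lemma to_nat_add m n : N.to_nat (N.add m n) = N.to_nat m + N.to_nat n.
Proof. exact: N2Nat.inj_add. Qed.

Lemma to_nat_mul m n : N.to_nat (N.mul m n) = N.to_nat m * N.to_nat n.
Proof. exact: N2Nat.inj_mul. Qed.

Lemma to_nat_sub m n : N.to_nat (N.sub m n) = N.to_nat m - N.to_nat n.
Proof. exact: N2Nat.inj_sub. Qed.

Lemma to_nat_leb m n : N.leb m n = (N.to_nat m <= N.to_nat n).
Proof.
by apply/N.leb_spec0/ssrnat.leP => [|?]; rewrite /N.le N2Nat.inj_compare;
  apply PeanoNat.Nat.compare_le_iff.
Qed.

Lemma to_nat_b2N b : N.to_nat (b2N b) = b.
Proof. by case: b. Qed.

Lemma to_nat_sum (T : Type) (f : T -> N) s :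
  N.to_nat (sumN f s) = \sum_(t <- s) N.to_nat (f t).
Proof. by elim: s => [|t s IH] /=; rewrite ?big_nil // big_cons to_nat_add IH. Qed.

Definition to_natE :=
  (to_nat_add, to_nat_mul, to_nat_sub, to_nat_b2N, to_nat_sum, to_nat_leb).

(** The elements with the first pattern move to the front and induction sorts the rest. The elements
    themselves are permuted, so the colours behind the patterns remain available. *)
Lemma perm_multisets (X : eqType) (T : eqType) (f : X -> T) (ts : seq T) (l : seq X) :
  all (fun x => f x \in ts) l ->
  exists2 l', perm_eq l' l & map f l' \in multisets ts (size l).
Proof.
elim: ts l => [|t ts IH] l; first by case: l => // _; exists [::].
move=> /allP lP; pose p := [pred x | f x == t].
have [|l' l'P l'M] := IH (filter (predC p) l).
  apply/allP => x; rewrite mem_filter /= => /andP[xt /lP].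
  by rewrite inE (negPf xt).
exists (filter p l ++ l').
  by apply: (perm_trans _ (permEl (perm_filterC p l))); rewrite perm_cat2l.
apply/flattenP.
pose j := count p l.
exists [seq nseq j t ++ r | r <- multisets ts (size l - j)].
  by apply: (map_f (fun j => _)); rewrite mem_iota /= add0n ltnS count_size.
rewrite map_cat; suff -> : map f (filter p l) = nseq j t.
  apply: map_f; move: l'M; rewrite size_filter.
  by rewrite -(count_predC p l) /j addKn.
rewrite /j -size_filter; elim: {+}l => //= x s; case: eqP => //= -> -> //.
Qed.

(** * Counting partial colourings for given lists *)

Section Weights.

Local Notation Q := 'I_7.
Implicit Types (L : {set Q}) (c x z : Q).

Definition avail L x z : nat := #|L :\: [set x; z]|.

(** The number of ways to colour v1, v2, v3 with z at v2, given x at v0: v1 and v3 are not adjacent,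
    so their choices multiply. *)
Definition path_weight L1 L2 L3 x z : nat := (z \in L2) * (avail L1 x z * avail L3 x z).

Definition total_weight L1 L2 L3 x : nat := \sum_z path_weight L1 L2 L3 x z.

Lemma avail_neq L x z : x != z -> avail L x z = #|L| - (x \in L) - (z \in L).
Proof.
move=> xz; rewrite /avail -setDDl.
have := cardsD1 x L; have := cardsD1 z (L :\ x).
by rewrite !inE eq_sym xz /= => -> ->; rewrite !addKn.
Qed.

Lemma avail_eq L x : avail L x x = #|L| - (x \in L).
Proof. by rewrite /avail setUid; have := cardsD1 x L => ->; rewrite addKn. Qed.

Section Types.
Variables (L1 L2 L3 : {set Q}).
Hypotheses (hL1 : 5 <= #|L1|) (hL2 : 5 <= #|L2|) (hL3 : 5 <= #|L3|).
Let w := path_weight L1 L2 L3.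
Let tot := total_weight L1 L2 L3.
Definition typ_of (q : Q) : bool * bool * bool := (q \in L1, q \in L2, q \in L3).
Let ty := typ_of.
Variable s : seq Q.
Hypothesis sP : perm_eq s (index_enum Q).

Let s_uniq : uniq s. Proof. by rewrite (perm_uniq sP) index_enum_uniq. Qed.

Lemma big_colours (F : Q -> nat) : \sum_(q <- s) F q = \sum_q F q.
Proof. exact: perm_big. Qed.

Lemma card_typ1 : N.to_nat (sumN (fun t => b2N t.1.1) (map ty s)) = #|L1|.
Proof.
rewrite !to_natE big_map big_colours -sum1_card [RHS]big_mkcond /=.
by apply: eq_bigr => q _; rewrite to_natE; case: ifP.
Qed.

Lemma card_typ3 : N.to_nat (sumN (fun t => b2N t.2) (map ty s)) = #|L3|.
Proof.
rewrite !to_natE big_map big_colours -sum1_card [RHS]big_mkcond /=.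
by apply: eq_bigr => q _; rewrite to_natE; case: ifP.
Qed.

Lemma few_missing_types : few_missing (map ty s).
Proof.
have cnt (L : {set Q}) : 5 <= #|L| -> count (fun q => q \notin L) s <= 2.
  move=> hL; rewrite -sum1_count big_mkcond (big_colours (fun q => if q \notin L then 1 else 0)).
  rewrite -big_mkcond sum1_card -(leq_add2l #|L|) cardC card_ord.
  by apply: leq_trans (leq_add hL (leqnn 2)).
by rewrite /few_missing !count_map; apply/and3P; split; apply: cnt.
Qed.

Let l1 := sumN (fun t => b2N t.1.1) (map ty s).
Let l3 := sumN (fun t => b2N t.2) (map ty s).

Lemma to_nat_weightN x z : x != z -> N.to_nat (weightN l1 l3 (ty x) (ty z)) = w x z.
Proof.
move=> xz; rewrite /weightN /w /path_weight /=; case: (z \in L2); rewrite ?mul0n ?mul1n //.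
by rewrite to_nat_mul !to_nat_sub card_typ1 card_typ3 !to_nat_b2N !avail_neq.
Qed.

Lemma to_nat_diag_weightN x : N.to_nat (diag_weightN l1 l3 (ty x)) = w x x.
Proof.
rewrite /diag_weightN /w /path_weight /=; case: (x \in L2); rewrite ?mul0n ?mul1n //.
by rewrite to_nat_mul !to_nat_sub card_typ1 card_typ3 !to_nat_b2N !avail_eq.
Qed.

Lemma to_nat_tot x r : perm_eq (x :: r) s ->
  N.to_nat (N.add (diag_weightN l1 l3 (ty x)) (sumN (weightN l1 l3 (ty x)) (map ty r))) = tot x.
Proof.
move=> rP; rewrite /tot /total_weight -big_colours -(perm_big _ rP) big_cons.
rewrite !to_natE to_nat_diag_weightN big_map; congr (_ + _).
apply: eq_big_seq => z zr; rewrite to_nat_weightN //.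
by apply: contraL zr => /eqP <-; have := perm_uniq rP; rewrite s_uniq /= => /andP[].
Qed.

(** [weightN] is meant for distinct colours; summing it over all of [s] adds a spurious term for x
    against itself, which [D] in [theta_check] accounts for. *)
Lemma to_nat_tot_diag x :
  N.to_nat (N.add (diag_weightN l1 l3 (ty x)) (sumN (weightN l1 l3 (ty x)) (map ty s))) =
  tot x + N.to_nat (weightN l1 l3 (ty x) (ty x)).
Proof.
have xs : x \in s by rewrite (perm_mem sP) mem_index_enum.
rewrite /tot /total_weight -big_colours (bigD1_seq x) //= to_nat_add to_nat_diag_weightN -addnA.
congr (_ + _); rewrite to_nat_sum big_map (bigD1_seq x) //= addnC; congr (_ + _).
by apply: eq_bigr => z zx; rewrite to_nat_weightN // eq_sym.
Qed.

End Types.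

Lemma typ_in (t : bool * bool * bool) : t \in types.
Proof. by case: t => [[[] []] []]. Qed.

Section Bounds.
Variables (L1 L2 L3 : {set Q}).
Hypotheses (hL1 : 5 <= #|L1|) (hL2 : 5 <= #|L2|) (hL3 : 5 <= #|L3|).
Let w := path_weight L1 L2 L3.
Let tot := total_weight L1 L2 L3.
Let ty := typ_of L1 L2 L3.

(** The right side grows with A, so four colours of A suffice. Together with c and the two remaining
    colours they form one of the enumerated configurations. *)
Lemma theta_bound c (A : {set Q}) : c \notin A -> 4 <= #|A| ->
  1000 * tot c <= N.to_nat (theta1000 (c \in L1) (c \in L3)) *
                 (\sum_(x in A) tot x + tot c).
Proof.
move=> cA hA; pose r0 := take 4 (enum A).
have r0A : {subset r0 <= A} by move=> q /mem_take; rewrite mem_enum.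
have sz0 : size r0 = 4 by rewrite size_takel // -cardE.
have u0 : uniq r0 by rewrite take_uniq ?enum_uniq.
have cr0 : c \notin r0 by apply: contra cA => /r0A.
pose e := [seq q <- index_enum Q | q \notin c :: r0].
have eP : perm_eq (e ++ c :: r0) (index_enum Q).
  apply: uniq_perm; rewrite ?index_enum_uniq //; last first.
    by move=> q; rewrite mem_cat mem_filter mem_index_enum andbT orNb.
  rewrite cat_uniq filter_uniq ?index_enum_uniq // cons_uniq cr0 u0 !andbT.
  by apply/hasPn => q qc; rewrite mem_filter negb_and qc.
have : size e = 2.
  apply/eqP; rewrite -(eqn_add2r (size (c :: r0))) -size_cat (perm_size eP) /= sz0.
  by rewrite /index_enum -enumT -cardE card_ord.
case: e eP => [|e1 [|e2 []]] // eP _.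
have r0T : all (fun q => ty q \in types) r0 by apply/allP => q _; apply: typ_in.
have [r rP] := perm_multisets r0T.
rewrite sz0 => rM.
have sP : perm_eq [:: c, e1, e2 & r] (index_enum Q).
  apply: perm_trans eP; rewrite -(cat1s c) -[[:: e1, e2 & r]]/([:: e1; e2] ++ r).
  by rewrite perm_catCA /= !perm_cons.
have tyr : few_missing (map ty r).
  have /and3P[] := few_missing_types hL1 hL2 hL3 sP; rewrite /few_missing !map_cons -/ty /=.
  by move=> h1 h2 h3; apply/and3P; split; [move: h1|move: h2|move: h3];
    rewrite ?addnA; apply: leq_trans; rewrite leq_addl.
have := theta_checks_true; rewrite /theta_checks => /allP /(_ _ rM); rewrite tyr implyTb.
move=> /allP/(_ (ty c) (typ_in _))/allP/(_ (ty e1) (typ_in _))/allP/(_ (ty e2) (typ_in _)).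
rewrite /theta_check -!map_cons (few_missing_types hL1 hL2 hL3 sP) implyTb to_nat_leb.
set l1 := sumN _ _; set l3 := sumN _ _.
set Nc := N.add (diag_weightN l1 l3 (ty c)) _.
have NcE : N.to_nat Nc = tot c by rewrite (to_nat_tot _ _ _ sP).
clearbody Nc; rewrite !(to_nat_add, to_nat_mul) NcE !to_nat_sum !big_map.
under [X in _ <= _ * (X + _) -> _]eq_bigr => x _ do rewrite (to_nat_tot_diag _ _ _ sP).
(* The spurious diagonal terms equal the [D] term on the left and cancel. *)
rewrite big_split /= addnAC mulnDr leq_add2r => /leq_trans; apply.
rewrite leq_mul // leq_add2r (perm_big _ rP) /= big_uniq //.
rewrite [leqRHS](bigID (mem r0)) /=; apply: leq_trans (leq_addr _ _).
rewrite leq_eqVlt; apply/orP; left; apply/eqP.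
by apply: eq_bigl => q /=; case: (boolP (q \in r0)) => [/r0A ->|]; rewrite ?andbF.
Qed.

Lemma pair_perm c x : c != x ->
  exists2 r, perm_eq [:: c, x & r] (index_enum Q) & map ty r \in multisets types 5.
Proof.
move=> cx; pose r0 := rem x (rem c (index_enum Q)).
have r0P : perm_eq [:: c, x & r0] (index_enum Q).
  rewrite perm_sym; apply: perm_trans (perm_to_rem (mem_index_enum c)) _.
  rewrite perm_cons perm_to_rem // mem_rem_uniq ?index_enum_uniq //.
  by rewrite inE eq_sym cx mem_index_enum.
have r0T : all (fun q => ty q \in types) r0 by apply/allP => q _; apply: typ_in.
have [r rP rM] := perm_multisets r0T; exists r.
  by apply: perm_trans r0P; rewrite !perm_cons.
suff r05 : size r0 = 5 by rewrite r05 in rM.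
by have := perm_size r0P; rewrite /index_enum -enumT -cardE card_ord /= => -[].
Qed.

Lemma pair_perm_neq c x r z : perm_eq [:: c, x & r] (index_enum Q) -> z \in r ->
  c != z /\ x != z.
Proof.
move=> /perm_uniq; rewrite index_enum_uniq /= => /and3P[].
rewrite inE negb_or => /andP[_ cr] xr _ zr.
by split; [move: cr|move: xr]; apply: contraNneq => ->.
Qed.

Lemma few_missing_behead2 (c x : bool * bool * bool) r : few_missing [:: c, x & r] -> few_missing r.
Proof.
move=> /and3P[h1 h2 h3]; apply/and3P.
by split; [move: h1|move: h2|move: h3] => /=;
  rewrite ?addnA; apply: leq_trans; rewrite leq_addl.
Qed.

Lemma kappa_bound c x : c != x ->
  1000 * \sum_z (w c z * tot x - w x z * tot c) <=
  N.to_nat (kappa1000 (c \in L1) (c \in L3)) * (tot x * tot c).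
Proof.
move=> cx; have [r sP rM] := pair_perm cx.
have few := few_missing_types hL1 hL2 hL3 sP.
have := pair_checks_true; rewrite /pair_checks => /allP /(_ _ rM).
rewrite (few_missing_behead2 few) implyTb.
move=> /allP/(_ (ty c) (typ_in _))/allP/(_ (ty x) (typ_in _))/andP[+ _].
rewrite /kappa_check -!map_cons few implyTb to_nat_leb.
set l1 := sumN _ _; set l3 := sumN _ _.
have xP : perm_eq (x :: c :: r) [:: c, x & r].
  by rewrite -(cat1s x) -(cat1s c) perm_catCA.
set Nc := N.add (diag_weightN l1 l3 (ty c)) _.
have NcE : N.to_nat Nc = tot c by rewrite (to_nat_tot _ _ _ sP).
set Nx := N.add (diag_weightN l1 l3 (ty x)) _.
have NxE : N.to_nat Nx = tot x by rewrite (to_nat_tot _ _ _ sP).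
clearbody Nc Nx; rewrite !(to_nat_mul, to_nat_add, to_nat_sub) to_nat_sum big_map NcE NxE.
have xc : x != c by rewrite eq_sym.
rewrite !(to_nat_diag_weightN _ _ _ sP) // !(to_nat_weightN _ _ _ sP) //.
suff -> : \sum_z (w c z * tot x - w x z * tot c) =
    (w c c * tot x - w x c * tot c + (w c x * tot x - w x x * tot c) +
    \sum_(z <- r) N.to_nat (N.sub (N.mul (weightN l1 l3 (ty c) (ty z)) Nx)
                                  (N.mul (weightN l1 l3 (ty x) (ty z)) Nc))) by [].
rewrite -(perm_big _ sP) /= !big_cons -addnA; congr (_ + (_ + _)).
apply: eq_big_seq => z zr; have [cz xz] := pair_perm_neq sP zr.
by rewrite to_nat_sub !to_nat_mul !(to_nat_weightN _ _ _ sP) // NcE NxE.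
Qed.

Lemma tau_bound c x : c != x ->
  1000 * \sum_z (if #|L1 :\: [set c; x; z]| <= 2 then 4 else 3) * w x z <= 3612 * tot x.
Proof.
move=> cx; have [r sP rM] := pair_perm cx.
have few := few_missing_types hL1 hL2 hL3 sP.
have := pair_checks_true; rewrite /pair_checks => /allP /(_ _ rM).
rewrite (few_missing_behead2 few) implyTb.
move=> /allP/(_ (ty c) (typ_in _))/allP/(_ (ty x) (typ_in _))/andP[_].
rewrite /tau_check -!map_cons few implyTb to_nat_leb.
set l1 := sumN _ _; set l3 := sumN _ _.
have xP : perm_eq (x :: c :: r) [:: c, x & r].
  by rewrite -(cat1s x) -(cat1s c) perm_catCA.
set Nx := N.add (diag_weightN l1 l3 (ty x)) (sumN _ _).
have NxE : N.to_nat Nx = tot x by rewrite (to_nat_tot _ _ _ sP).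
have xc : x != c by rewrite eq_sym.
set B := N.sub (N.sub l1 _) _.
have BE : N.to_nat B = #|L1 :\: [set c; x]|.
  by rewrite !to_nat_sub !to_nat_b2N (card_typ1 _ _ _ sP) setUC -(avail_neq _ xc).
have coefE m : N.to_nat (coefN m) = if N.to_nat m <= 2 then 4 else 3.
  by rewrite /coefN to_nat_leb; case: ifP.
clearbody Nx B; rewrite !(to_nat_mul, to_nat_add, coefE, BE) to_nat_sum big_map NxE.
rewrite (to_nat_diag_weightN _ _ _ sP) // (to_nat_weightN _ _ _ sP) //.
suff -> : \sum_z (if #|L1 :\: [set c; x; z]| <= 2 then 4 else 3) * w x z =
    ((if #|L1 :\: [set c; x]| <= 2 then 4 else 3) * (w x x + w x c) +
    \sum_(z <- r) N.to_nat (N.mul (coefN (N.sub B (b2N (ty z).1.1)))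
                                  (weightN l1 l3 (ty x) (ty z)))) by [].
rewrite -(perm_big _ sP) /= !big_cons addnA; congr (_ + _).
  (* For z = c and z = x the removed set collapses to {c, x}. *)
  by rewrite [[set c; x; c]]setUAC -[[set c; x; x]]setUA !setUid mulnDr addnC.
apply: eq_big_seq => z zr; have [cz xz] := pair_perm_neq sP zr.
rewrite to_nat_mul coefE (to_nat_weightN _ _ _ sP) // to_nat_sub BE to_nat_b2N /=.
congr ((if _ <= _ then _ else _) * _).
have := cardsD1 z (L1 :\: [set c; x]); rewrite !inE negb_or eq_sym cz eq_sym xz /=.
by rewrite setDDl => ->; rewrite addKn.
Qed.

End Bounds.

End Weights.

Local Open Scope ring_scope.

(** * Weighted averages *)

Section Averages.
Variables (R : realFieldType) (T : finType).
Implicit Types (w g : T -> R) (S : {set T}).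

Definition wavg w S g : R := (\sum_(q in S) w q * g q) / \sum_(q in S) w q.

Definition uavg S g : R := wavg (fun=> 1) S g.

Lemma wavg_setU1 w g (B : {set T}) (c : T) : (forall q, 0 < w q) -> c \notin B -> (0 < #|B|)%N ->
  wavg w (c |: B) g =
  wavg w B g + w c / (\sum_(q in B) w q + w c) * (g c - wavg w B g).
Proof.
move=> w0 cB /card_gt0P[q qB]; rewrite /wavg !big_setU1 //=.
have W0 : 0 < \sum_(q in B) w q.
  by rewrite (bigD1 q) //= ltr_wpDr // sumr_ge0 // => i _; exact: ltW.
have := w0 c; set W := \sum_(q in B) w q in W0 *; set S := \sum_(q in B) _.
by move=> wc; field; rewrite !gt_eqF //= ?addr_gt0 // addrC addr_gt0.
Qed.

(** Here t and t' are the shares of the exchanged colours and m is the average over the common part.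
    The form (t - t')(C - m) + t'(C - D) only compares with the heavier colour; multiplying by t
    makes the hypotheses applicable. *)
Lemma exchange_bound (t t' m C D E : R) : 0 <= t' -> t' <= t -> 0 <= E ->
  t * `|C - m| <= E -> t * `|C - D| <= E ->
  `|t * (C - m) - t' * (D - m)| <= E.
Proof.
move=> t'0 t't E0 h1 h2.
have [t0|t0] := leP t 0.
  have -> : t = 0 by apply/eqP; rewrite eq_le t0 (le_trans t'0).
  have -> : t' = 0 by apply/eqP; rewrite eq_le t'0 (le_trans t't).
  by rewrite !mul0r subrr normr0.
have -> : t * (C - m) - t' * (D - m) = (t - t') * (C - m) + t' * (C - D) by ring.
apply: (le_trans (ler_normD _ _)).
rewrite !normrM !(@ger0_norm _ t', @ger0_norm _ (t - t')) ?subr_ge0 //.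
rewrite -(ler_pM2l t0).
have -> : t * ((t - t') * `|C - m| + t' * `|C - D|) =
  (t - t') * (t * `|C - m|) + t' * (t * `|C - D|) by ring.
have -> : t * E = (t - t') * E + t' * E by ring.
by rewrite lerD // ler_wpM2l ?subr_ge0.
Qed.

Lemma card_le1_cases S : (#|S| <= 1)%N -> S = set0 \/ exists c, S = [set c].
Proof.
rewrite leq_eqVlt ltnS leqn0 cards_eq0 => /orP[/cards1P[c ->]|/eqP ->]; last by left.
by right; exists c.
Qed.

Lemma sum_set_gt0 w (B : {set T}) : (forall q, 0 < w q) -> (0 < #|B|)%N -> 0 < \sum_(q in B) w q.
Proof.
move=> w0 /card_gt0P[q qB]; rewrite (bigD1 q) //= ltr_wpDr // sumr_ge0 // => i _.
exact: ltW.
Qed.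

Lemma wavg_dist w g (B : {set T}) a M : (forall q, 0 < w q) -> (0 < #|B|)%N ->
  (forall q, q \in B -> `|a - g q| <= M) -> `|a - wavg w B g| <= M.
Proof.
move=> w0 B0 gM; have W0 := sum_set_gt0 w0 B0; rewrite /wavg.
have -> : a - (\sum_(q in B) w q * g q) / \sum_(q in B) w q =
  (\sum_(q in B) w q * (a - g q)) / \sum_(q in B) w q.
  under [in RHS]eq_bigr => q _ do rewrite mulrBr.
  by rewrite sumrB -mulr_suml; field; rewrite gt_eqF.
rewrite normrM normfV (gtr0_norm W0) ler_pdivrMr // mulrC mulr_suml.
apply: (le_trans (ler_norm_sum _ _ _)); apply: ler_sum => q qB.
by rewrite normrM (gtr0_norm (w0 q)) ler_pM2l // gM.
Qed.

(* If [c] is the heavier of the two exchanged colours, the difference of the averages is a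
   combination of [g c - g d] and of [g c] minus the average over the common part, with
   nonnegative coefficients adding up to the share of [c]. *)
Lemma wavg_exchange w g S S' E :
  (forall q, 0 < w q) -> 0 <= E -> (0 < #|S :&: S'|)%N ->
  (#|S :\: S'| <= 1)%N -> (#|S' :\: S| <= 1)%N ->
  (forall q q', q \in (S :\: S') :|: (S' :\: S) ->
    w q * `|g q - g q'| <= E * (\sum_(p in S :&: S') w p + w q)) ->
  `|wavg w S g - wavg w S' g| <= E.
Proof.
move=> w0 E0; set B := S :&: S' => B0 S1 S1' h.
have W0 := sum_set_gt0 w0 B0; set W := \sum_(p in B) w p in W0 h.
set m := wavg w B g.
have tm q : q \in (S :\: S') :|: (S' :\: S) -> w q / (W + w q) * `|g q - m| <= E.
  move=> qS; rewrite mulrC -ler_pdivlMr ?divr_gt0 ?addr_gt0 //.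
  apply: wavg_dist => // q' _; rewrite ler_pdivlMr ?divr_gt0 ?addr_gt0 // mulrC.
  by rewrite mulrAC ler_pdivrMr ?addr_gt0 //; apply: h.
have tt q q' : q \in (S :\: S') :|: (S' :\: S) -> w q / (W + w q) * `|g q - g q'| <= E.
  by move=> qS; rewrite mulrAC ler_pdivrMr ?addr_gt0 //; apply: h.
have t0 q : 0 <= w q / (W + w q) by rewrite divr_ge0 ?addr_ge0 // ltW.
have SE : S = (S :\: S') :|: B by rewrite setUC /B setID.
have SE' : S' = (S' :\: S) :|: B by rewrite setUC /B setIC setID.
have nB (c : T) : (c \in S :\: S') || (c \in S' :\: S) -> c \notin B.
  by rewrite !inE negb_and; case: (c \in S); case: (c \in S').
have [D|[c D]] := card_le1_cases S1; have [D'|[d D']] := card_le1_cases S1';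
  rewrite D in SE; rewrite D' in SE'; rewrite D D' in nB tm tt;
  rewrite SE SE' ?set0U ?wavg_setU1 ?nB ?inE ?eqxx ?orbT // -/m -?/W.
- by rewrite subrr normr0.
- by rewrite opprD addrA subrr sub0r normrN normrM ger0_norm // tm // !inE eqxx.
- by rewrite addrAC subrr add0r normrM ger0_norm // tm // !inE eqxx.
have cD : c \in [set c] :|: [set d] by rewrite !inE eqxx.
have dD : d \in [set c] :|: [set d] by rewrite !inE eqxx orbT.
rewrite opprD addrACA subrr add0r.
(* The colour with the larger share is the reference; the other case is symmetric. *)
have [le|/ltW le] := leP (w d / (W + w d)) (w c / (W + w c)).
  by apply: exchange_bound; rewrite ?tm ?tt.
by rewrite distrC; apply: exchange_bound; rewrite ?tm ?tt.
Qed.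

Lemma uavgE S g : uavg S g = (\sum_(q in S) g q) / #|S|%:R.
Proof. by rewrite /uavg /wavg sumr_const; under eq_bigr do rewrite mul1r. Qed.

Lemma uavg_const S a : (0 < #|S|)%N -> uavg S (fun=> a) = a.
Proof.
by move=> S0; rewrite uavgE sumr_const -[a *+ _]mulr_natr mulfK // pnatr_eq0 -lt0n.
Qed.

(** With unit weights, the share of an exchanged element is one over the size of the common part
    plus one. *)
Lemma uavg_exchange g S S' M :
  (0 < #|S :&: S'|)%N -> (#|S :\: S'| <= 1)%N -> (#|S' :\: S| <= 1)%N ->
  (forall q q', `|g q - g q'| <= M) ->
  `|uavg S g - uavg S' g| <= M / #|S :&: S'|.+1%:R.
Proof.
move=> B0 S1 S1' gM; have M0 : 0 <= M by case/card_gt0P: B0 => q _; apply: le_trans (gM q q).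
apply: wavg_exchange => //; first by rewrite divr_ge0.
by move=> q q' _; rewrite mul1r sumr_const -(natrD _ _ 1) addn1 divfK ?pnatr_eq0 // gM.
Qed.

Lemma uavg_dist g g' S e : (0 < #|S|)%N -> (forall q, `|g q - g' q| <= e) ->
  `|uavg S g - uavg S g'| <= e.
Proof.
move=> S0 h; rewrite !uavgE -mulrBl -sumrB normrM normfV normr_nat.
rewrite ler_pdivrMr ?ltr0n // (le_trans (ler_norm_sum _ _ _)) //.
by rewrite mulr_natr -sumr_const; apply: ler_sum.
Qed.

End Averages.

(** Replace S1 by S1' while averaging f, then f by f', then S3 by S3' while averaging f'. Hence [M1]
    concerns f and [M3] concerns f'. *)
Lemma pair_avg_dist (R : realFieldType) (T : finType) (f f' : T -> T -> R)
    (S1 S1' S3 S3' : {set T}) (e M1 M3 : R) :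
  (0 < #|S1 :&: S1'|)%N -> (#|S1 :\: S1'| <= 1)%N -> (#|S1' :\: S1| <= 1)%N ->
  (0 < #|S3 :&: S3'|)%N -> (#|S3 :\: S3'| <= 1)%N -> (#|S3' :\: S3| <= 1)%N ->
  (forall y w, `|f y w - f' y w| <= e) ->
  (forall y y' w, `|f y w - f y' w| <= M1) -> (forall y w w', `|f' y w - f' y w'| <= M3) ->
  `|uavg S1 (fun y => uavg S3 (f y)) - uavg S1' (fun y => uavg S3' (f' y))| <=
  e + M1 / #|S1 :&: S1'|.+1%:R + M3 / #|S3 :&: S3'|.+1%:R.
Proof.
move=> B1 h1 h1' B3 h3 h3' fe fM1 fM3.
have c1 : (0 < #|S1'|)%N by rewrite (leq_trans B1) // subset_leq_card // subsetIr.
have c3 : (0 < #|S3|)%N by rewrite (leq_trans B3) // subset_leq_card // subsetIl.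
have -> : uavg S1 (fun y => uavg S3 (f y)) - uavg S1' (fun y => uavg S3' (f' y)) =
   (uavg S1' (fun y => uavg S3 (f y)) - uavg S1' (fun y => uavg S3 (f' y))) +
   (uavg S1 (fun y => uavg S3 (f y)) - uavg S1' (fun y => uavg S3 (f y))) +
   (uavg S1' (fun y => uavg S3 (f' y)) - uavg S1' (fun y => uavg S3' (f' y))) by ring.
apply: (le_trans (ler_normD _ _)); apply: lerD; last first.
  by apply: uavg_dist => // y; apply: uavg_exchange.
apply: (le_trans (ler_normD _ _)); apply: lerD.
  by apply: uavg_dist => // y; apply: uavg_dist.
by apply: uavg_exchange => // y y'; apply: uavg_dist.
Qed.

(** Equal total masses allow g to be shifted by its minimum. It is then nonnegative and at most M,
    and only the positive parts of p - q contribute to an upper bound. *)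
Lemma tv_bound (R : realFieldType) (T : finType) (z0 : T) (p q g : T -> R) (K M : R) :
  \sum_z p z = \sum_z q z -> \sum_z Num.max 0 (p z - q z) <= K ->
  (forall z z', `|g z - g z'| <= M) ->
  `|\sum_z (p z - q z) * g z| <= K * M.
Proof.
move=> pq hK; wlog suff H : g / (forall z z', `|g z - g z'| <= M) ->
    \sum_z (p z - q z) * g z <= K * M.
  move=> gM; rewrite ler_norml H // andbT lerNl -sumrN.
  under eq_bigr => z _ do rewrite -mulrN.
  by apply: (H (fun z => - g z)) => z z'; rewrite -opprD normrN.
move=> gM; case: (@Order.TotalTheory.arg_minP _ _ _ z0 predT g isT) => zm _ zmP.
have -> : \sum_z (p z - q z) * g z = \sum_z (p z - q z) * (g z - g zm).
  under [RHS]eq_bigr => z _ do rewrite mulrBr.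
  by rewrite sumrB -mulr_suml sumrB pq subrr mul0r subr0.
have M0 : 0 <= M by apply: le_trans (gM z0 z0).
apply: le_trans (ler_wpM2r M0 hK); rewrite mulr_suml; apply: ler_sum => z _.
have g0 : 0 <= g z - g zm by rewrite subr_ge0 zmP.
apply: (@le_trans _ _ (Num.max 0 (p z - q z) * (g z - g zm))).
  by rewrite ler_wpM2r // le_max lexx orbT.
by rewrite ler_wpM2l ?le_max ?lexx // (le_trans (ler_norm _)).
Qed.

(** * Uniform list colourings of a 4-cycle *)

Section Cycle.
Variable R : realFieldType.
Local Notation Q := 'I_7.
Implicit Types (L : {set Q}) (f : Q -> Q -> Q -> Q -> R).

Definition cycle_ok L0 L1 L2 L3 x y z w : bool :=
  [&& [&& x \in L0, y \in L1, z \in L2 & w \in L3], x != y, y != z, z != w & w != x].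

(** Summing an indicator over all colours turns rotation of the cycle into an exchange of sums. *)
Definition cycle_sum L0 L1 L2 L3 f : R :=
  \sum_x \sum_y \sum_z \sum_w (cycle_ok L0 L1 L2 L3 x y z w)%:R * f x y z w.

Definition cycle_avg L0 L1 L2 L3 f : R :=
  cycle_sum L0 L1 L2 L3 f / cycle_sum L0 L1 L2 L3 (fun _ _ _ _ => 1).

(** * Conditional averages given the colour of one corner *)

Section FirstCorner.
Variables (L1 L2 L3 : {set Q}).
Hypotheses (hL1 : (5 <= #|L1|)%N) (hL2 : (5 <= #|L2|)%N) (hL3 : (5 <= #|L3|)%N).
Let W x z : R := (path_weight L1 L2 L3 x z)%:R.
Let N x : R := (total_weight L1 L2 L3 x)%:R.

Definition side_avg f x z : R :=
  uavg (L1 :\: [set x; z]) (fun y => uavg (L3 :\: [set x; z]) (fun w => f x y z w)).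

(** The F of the overview: the conditional mean of f given x at v0, with v2 revealed before the two
    sides. *)
Definition corner_avg f x : R := (\sum_z W x z * side_avg f x z) / N x.

Lemma card_setD_ge (k : nat) L (D : {set Q}) : (5 <= #|L|)%N -> (#|L :&: D| <= k)%N ->
  (5 - k <= #|L :\: D|)%N.
Proof. by move=> hL hD; rewrite cardsD leq_sub. Qed.

Lemma avail_ge3 L x z : (5 <= #|L|)%N -> (3 <= avail L x z)%N.
Proof.
move=> hL; apply: (@card_setD_ge 2) => //.
by rewrite (leq_trans (subset_leq_card (subsetIr _ _))) // cards2; case: eqP.
Qed.

Lemma total_weight_gt0 x : 0 < N x.
Proof.
rewrite ltr0n; have /card_gt0P[z zL] : (0 < #|L2|)%N by apply: leq_trans hL2.
rewrite /total_weight (bigD1 z) //= /path_weight zL mul1n addn_gt0 muln_gt0.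
by rewrite !(leq_trans _ (avail_ge3 _ _ _)).
Qed.

Lemma total_weightE x : N x = \sum_z W x z.
Proof. by rewrite /N natr_sum. Qed.

Lemma cycle_sumE L0 f : cycle_sum L0 L1 L2 L3 f = \sum_(x in L0) N x * corner_avg f x.
Proof.
rewrite [RHS]big_mkcond; apply: eq_bigr => x _.
(* The sum over z comes before the sum over y, since y and w decouple once x and z are fixed. *)
rewrite exchange_big /=; case: ifPn => xL0; last first.
  rewrite big1 // => z _; rewrite big1 // => y _; rewrite big1 // => w _.
  by rewrite /cycle_ok (negPf xL0) mul0r.
rewrite /corner_avg mulrC divfK ?gt_eqF ?total_weight_gt0 //; apply: eq_bigr => z _.
rewrite /W /path_weight /side_avg !uavgE.
have [zL|zL] := boolP (z \in L2); last first.
  rewrite mul0r; rewrite big1 // => y _; rewrite big1 // => w _.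
  by rewrite /cycle_ok (negPf zL) !andbF mul0r.
rewrite mul1n natrM -/(avail L1 x z).
have a1 : (avail L1 x z)%:R != 0 :> R by rewrite pnatr_eq0 -lt0n (leq_trans _ (avail_ge3 _ _ _)).
have a3 : (avail L3 x z)%:R != 0 :> R by rewrite pnatr_eq0 -lt0n (leq_trans _ (avail_ge3 _ _ _)).
under [in RHS]eq_bigr => y _ do rewrite uavgE -/(avail L3 x z).
rewrite -mulr_suml; set S := (X in X / _ / _).
have -> : (avail L1 x z)%:R * (avail L3 x z)%:R * (S / (avail L3 x z)%:R / (avail L1 x z)%:R) = S.
  by field; rewrite a1 a3.
rewrite /S [RHS]big_mkcond; apply: eq_bigr => y _.
rewrite !inE negb_or; case: ifPn => [/andP[/andP[yx yz] yL]|h]; last first.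
  rewrite big1 // => w _; rewrite /cycle_ok xL0 zL /=.
  move: h; rewrite eq_sym; case: (x == y) => //=; rewrite ?andbF ?mul0r //.
  by case: (y == z) => //=; rewrite ?andbF ?mul0r // => /negPf ->; rewrite mul0r.
rewrite [RHS]big_mkcond; apply: eq_bigr => w _.
rewrite /cycle_ok xL0 yL zL eq_sym yx yz !inE negb_or /= [z == w]eq_sym.
by case: (w == x); case: (w == z); case: (w \in L3); rewrite ?mul1r ?mul0r.
Qed.

Lemma cycle_avgE L0 f : cycle_avg L0 L1 L2 L3 f = wavg N L0 (corner_avg f).
Proof.
rewrite /cycle_avg !cycle_sumE; congr (_ / _); apply: eq_bigr => x _.
suff -> : corner_avg (fun _ _ _ _ => 1) x = 1 by rewrite mulr1.
rewrite /corner_avg total_weightE.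
have -> : \sum_z W x z * side_avg (fun _ _ _ _ => 1) x z = \sum_z W x z.
  apply: eq_bigr => z _; rewrite /side_avg !uavg_const ?mulr1 //.
    exact: leq_trans (avail_ge3 x z hL3).
  exact: leq_trans (avail_ge3 x z hL1).
by rewrite divff // -total_weightE gt_eqF // total_weight_gt0.
Qed.

Variables (f : Q -> Q -> Q -> Q -> R) (d0 d1 d2 d3 : R).
Hypothesis f0 : forall x x' y z w, `|f x y z w - f x' y z w| <= d0.
Hypothesis f1 : forall x y y' z w, `|f x y z w - f x y' z w| <= d1.
Hypothesis f2 : forall x y z z' w, `|f x y z w - f x y z' w| <= d2.
Hypothesis f3 : forall x y z w w', `|f x y z w - f x y z w'| <= d3.

(** These are the lists left to a side corner when one of its neighbours changes from c to x. The
    common part loses at most three of at least five colours. *)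
Lemma setD_swap L (c x z : Q) : (5 <= #|L|)%N ->
  [/\ (L :\: [set c; z]) :&: (L :\: [set x; z]) = L :\: [set c; x; z],
      (0 < #|L :\: [set c; x; z]|)%N,
      (#|(L :\: [set c; z]) :\: (L :\: [set x; z])| <= 1)%N &
      (#|(L :\: [set x; z]) :\: (L :\: [set c; z])| <= 1)%N].
Proof.
move=> hL; split.
- by apply/setP => q; rewrite !inE; case: (q == c); case: (q == x); case: (q == z); case: (q \in L).
- apply: (@leq_trans 2) => //; apply: (@card_setD_ge 3) => //.
  rewrite (leq_trans (subset_leq_card (subsetIr _ _))) // setUC cardsU1 cards2.
  by case: (_ \in _); case: (_ != _).
- apply: (@leq_trans #|[set x]|); last by rewrite cards1.
  apply: subset_leq_card; apply/subsetP => q; rewrite !inE.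
  by case: (q == c); case: (q == x); case: (q == z); case: (q \in L).
- apply: (@leq_trans #|[set c]|); last by rewrite cards1.
  apply: subset_leq_card; apply/subsetP => q; rewrite !inE.
  by case: (q == c); case: (q == x); case: (q == z); case: (q \in L).
Qed.

Lemma side_avg_diff0 c x z :
  `|side_avg f c z - side_avg f x z| <=
  d0 + d1 / #|L1 :\: [set c; x; z]|.+1%:R + d3 / #|L3 :\: [set c; x; z]|.+1%:R.
Proof.
have [e1 p1 q1 r1] := setD_swap c x z hL1; have [e3 p3 q3 r3] := setD_swap c x z hL3.
by rewrite -e1 -e3; apply: pair_avg_dist; rewrite ?e1 ?e3.
Qed.

Lemma side_avg_diff2 c z z' :
  `|side_avg f c z - side_avg f c z'| <=
  d2 + d1 / #|L1 :\: [set z; z'; c]|.+1%:R + d3 / #|L3 :\: [set z; z'; c]|.+1%:R.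
Proof.
have [e1 p1 q1 r1] := setD_swap z z' c hL1; have [e3 p3 q3 r3] := setD_swap z z' c hL3.
rewrite -e1 -e3 /side_avg ![[set c; _]]setUC.
by apply: pair_avg_dist; rewrite ?e1 ?e3.
Qed.

Lemma oscillations_ge0 : [/\ 0 <= d0, 0 <= d1, 0 <= d2 & 0 <= d3].
Proof.
pose o : Q := ord0.
by split; [apply: le_trans (f0 o o o o o)|apply: le_trans (f1 o o o o o)|
  apply: le_trans (f2 o o o o o)|apply: le_trans (f3 o o o o o)].
Qed.

(** First the law of v2 changes, with c kept at v0, which costs K times the oscillation of
    [side_avg] in z. Then c becomes x, averaged over the law of v2 given x. Thus T is a mean of
    reciprocals, while t must bound them uniformly. *)
Lemma corner_avg_diff c x T K t :
  \sum_z Num.max 0 (W c z / N c - W x z / N x) <= K ->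
  \sum_z W x z / #|L1 :\: [set c; x; z]|.+1%:R <= T * N x ->
  \sum_z W x z / #|L3 :\: [set c; x; z]|.+1%:R <= T * N x ->
  (forall z z', #|L1 :\: [set z; z'; c]|.+1%:R^-1 <= t) ->
  (forall z z', #|L3 :\: [set z; z'; c]|.+1%:R^-1 <= t) ->
  `|corner_avg f c - corner_avg f x| <=
  d0 + (T + K * t) * (d1 + d3) + K * d2.
Proof.
move=> hK hT1 hT3 ht1 ht3; have [d0p d1p d2p d3p] := oscillations_ge0.
have Nc := total_weight_gt0 c; have Nx := total_weight_gt0 x.
have -> : corner_avg f c - corner_avg f x =
  \sum_z (W c z / N c - W x z / N x) * side_avg f c z +
  \sum_z W x z / N x * (side_avg f c z - side_avg f x z).
  rewrite /corner_avg !mulr_suml -sumrB -big_split; apply: eq_bigr => z _ /=.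
  by ring.
apply: (le_trans (ler_normD _ _)).
have -> : d0 + (T + K * t) * (d1 + d3) + K * d2 =
  K * (d2 + d1 * t + d3 * t) + (d0 + T * d1 + T * d3) by ring.
apply: lerD.
  apply: (tv_bound ord0) => //.
    by rewrite -!mulr_suml -!total_weightE !divff ?gt_eqF.
  move=> z z'; apply: (le_trans (side_avg_diff2 _ _ _)).
  by rewrite !lerD // ler_wpM2l.
apply: (le_trans (ler_norm_sum _ _ _)).
apply: (@le_trans _ _ (\sum_z W x z / N x * (d0 + d1 / #|L1 :\: [set c; x; z]|.+1%:R
   + d3 / #|L3 :\: [set c; x; z]|.+1%:R))).
  apply: ler_sum => z _; have p0 : 0 <= W x z / N x by rewrite divr_ge0.
  by rewrite normrM (ger0_norm p0) ler_wpM2l // side_avg_diff0.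
have -> : \sum_z W x z / N x * (d0 + d1 / #|L1 :\: [set c; x; z]|.+1%:R
   + d3 / #|L3 :\: [set c; x; z]|.+1%:R) =
   d0 * ((\sum_z W x z) / N x) + ((\sum_z W x z / #|L1 :\: [set c; x; z]|.+1%:R) / N x) * d1 +
   ((\sum_z W x z / #|L3 :\: [set c; x; z]|.+1%:R) / N x) * d3.
  rewrite !mulr_suml mulr_sumr -!big_split; apply: eq_bigr => z _ /=; ring.
rewrite -total_weightE divff ?gt_eqF // mulr1 !lerD // ler_wpM2r // ler_pdivrMr //.
Qed.

Lemma kappa_frac_le c x : c != x ->
  \sum_z Num.max 0 (W c z / N c - W x z / N x) <=
  (N.to_nat (kappa1000 (c \in L1) (c \in L3)))%:R / 1000.
Proof.
move=> cx; have Nc := total_weight_gt0 c; have Nx := total_weight_gt0 x.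
set k := N.to_nat _.
have := kappa_bound hL1 hL2 hL3 cx; rewrite -/k -(ler_nat R) !natrM natr_sum -/(N x) -/(N c).
set D := \sum_z (_ * _ - _)%N%:R => hD.
apply: (@le_trans _ _ (D / (N x * N c))); last first.
  by rewrite ler_pdivrMr ?mulr_gt0 // mulrAC ler_pdivlMr ?ltr0n // mulrC.
rewrite /D mulr_suml; apply: ler_sum => z _; have P0 := mulr_ge0 (ltW Nx) (ltW Nc).
rewrite ge_max divr_ge0 //=.
have -> : W c z / N c - W x z / N x = (W c z * N x - W x z * N c) / (N x * N c).
  by field; rewrite !gt_eqF.
rewrite ler_pM2r ?invr_gt0 ?mulr_gt0 // /W /N -!natrM lerBlDr -natrD ler_nat.
by rewrite addnC -leq_subLR.
Qed.
Lemma inv_card_le (D : {set Q}) (m : nat) : (m <= #|D|)%N ->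
  #|D|.+1%:R^-1 <= m.+1%:R^-1 :> R.
Proof. by move=> mD; rewrite lef_pV2 ?posrE ?ltr0n // ler_nat. Qed.

Lemma card_setD3_ge2 L x y z : (5 <= #|L|)%N -> (2 <= #|L :\: [set x; y; z]|)%N.
Proof.
move=> hL; apply: (@card_setD_ge 3) => //.
rewrite (leq_trans (subset_leq_card (subsetIr _ _))) // setUC cardsU1 cards2.
by case: (_ \in _); case: (_ != _).
Qed.

Lemma card_setD3_ge3 L x y z : (5 <= #|L|)%N -> x \notin L -> (3 <= #|L :\: [set x; y; z]|)%N.
Proof.
move=> hL xL; apply: (@card_setD_ge 2) => //.
apply: (@leq_trans #|[set y; z]|); last by rewrite cards2; case: eqP.
apply: subset_leq_card; apply/subsetP => q; rewrite !inE => /andP[qL].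
by have [eq|//] := eqVneq q x; rewrite -eq qL in xL.
Qed.

Lemma tau_frac_le c x : c != x ->
  \sum_z W x z / #|L1 :\: [set c; x; z]|.+1%:R <= 301 / 1000 * N x.
Proof.
move=> cx; have := tau_bound hL1 hL2 hL3 cx.
rewrite -(ler_nat R) !natrM natr_sum -/(N x) => h.
have {}h : \sum_z (if (#|L1 :\: [set c; x; z]| <= 2)%N then 4 else 3) * W x z <= 3612 / 1000 * N x.
  rewrite mulrAC ler_pdivlMr ?ltr0n // mulrC; apply: le_trans h; rewrite ler_wpM2l //.
  by apply: ler_sum => z _; rewrite natrM; case: ifP.
have -> : 301 / 1000 * N x = (3612 / 1000 * N x) / 12 by field.
rewrite ler_pdivlMr ?ltr0n //; apply: le_trans h; rewrite mulr_suml.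
apply: ler_sum => z _; rewrite -mulrA mulrC ler_wpM2r // mulrC ler_pdivrMr ?ltr0n //.
have n2 := card_setD3_ge2 c x z hL1; case: ifPn => [_|]; rewrite -natrM ler_nat.
  by rewrite -[12%N]/(4 * 3)%N leq_mul2l.
by rewrite -ltnNge => n3; rewrite -[12%N]/(3 * 4)%N leq_mul2l.
Qed.

(** As c is absent from L, removing {c, x, z} costs at most two colours and leaves three. *)
Lemma tau_frac_le4 (c x : Q) L : (5 <= #|L|)%N -> c \notin L ->
  \sum_z W x z / #|L :\: [set c; x; z]|.+1%:R <= 4^-1 * N x.
Proof.
move=> hL cL; rewrite total_weightE mulrC mulr_suml; apply: ler_sum => z _.
by rewrite ler_wpM2l // (inv_card_le (card_setD3_ge3 _ _ _ cL)).
Qed.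

End FirstCorner.

(** Reflecting the cycle exchanges v1 and v3, which carries the bound for L1 over to L3. *)
Lemma path_weightC L1 L2 L3 x z : path_weight L1 L2 L3 x z = path_weight L3 L2 L1 x z.
Proof. by rewrite /path_weight [X in (_ * X)%N]mulnC. Qed.

Lemma total_weightC L1 L2 L3 x : total_weight L1 L2 L3 x = total_weight L3 L2 L1 x.
Proof. by apply: eq_bigr => z _; rewrite path_weightC. Qed.

(* [d0] is the oscillation at the corner whose list changes and [d2] at the opposite one. *)
Definition influence (d0 d1 d2 d3 : R) : R :=
  283 / 1000 * d0 + 865 / 10000 * (d1 + d3) + 34 / 1000 * d2.

(** The share of c and the difference of conditional means are bounded separately and multiplied. A
    colour c outside L1 and L3 may have a larger share, but disturbs the other corners less, so two
    cases give better constants than one. *)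
Lemma cycle_avg_change L0 L0' L1 L2 L3 f d0 d1 d2 d3 :
  (4 <= #|L0 :&: L0'|)%N -> (#|L0 :\: L0'| <= 1)%N -> (#|L0' :\: L0| <= 1)%N ->
  (5 <= #|L1|)%N -> (5 <= #|L2|)%N -> (5 <= #|L3|)%N ->
  (forall x x' y z w, `|f x y z w - f x' y z w| <= d0) ->
  (forall x y y' z w, `|f x y z w - f x y' z w| <= d1) ->
  (forall x y z z' w, `|f x y z w - f x y z' w| <= d2) ->
  (forall x y z w w', `|f x y z w - f x y z w'| <= d3) ->
  `|cycle_avg L0 L1 L2 L3 f - cycle_avg L0' L1 L2 L3 f| <= influence d0 d1 d2 d3.
Proof.
move=> hA h0 h0' hL1 hL2 hL3 f0 f1 f2 f3.
have [d0p d1p d2p d3p] := oscillations_ge0 f0 f1 f2 f3.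
have E0 : 0 <= influence d0 d1 d2 d3 by rewrite /influence; lra.
rewrite !cycle_avgE //; apply: wavg_exchange => //.
- exact: total_weight_gt0.
- exact: leq_trans hA.
move=> c x cD; have cA : c \notin L0 :&: L0'.
  by move: cD; rewrite !inE; case: (c \in L0); case: (c \in L0').
have := theta_bound hL1 hL2 hL3 cA hA.
rewrite -(ler_nat R) !natrM natrD natr_sum.
set Nc := (total_weight _ _ _ c)%:R; set S := \sum_(p in _) _ => theta.
have Nc0 : 0 < Nc := total_weight_gt0 hL1 hL2 hL3 c.
have S0 : 0 <= S by rewrite sumr_ge0.
have [<-|cx] := eqVneq c x.
  by rewrite subrr normr0 mulr0; exact: mulr_ge0 E0 (addr_ge0 S0 (ltW Nc0)).
have hK := kappa_frac_le hL1 hL2 hL3 cx.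
have t1 z z' : #|L1 :\: [set z; z'; c]|.+1%:R^-1 <= 3^-1 :> R.
  exact: inv_card_le (card_setD3_ge2 _ _ _ _).
have t3 z z' : #|L3 :\: [set z; z'; c]|.+1%:R^-1 <= 3^-1 :> R.
  exact: inv_card_le (card_setD3_ge2 _ _ _ _).
have T1 := tau_frac_le hL1 hL2 hL3 cx.
have := tau_frac_le hL3 hL2 hL1 cx; rewrite -total_weightC.
under eq_bigr do rewrite -path_weightC.
move=> T3.
have main K T t k : (k%:R / 1000 = K :> R) -> 0 <= K ->
    1000 * Nc <= k%:R * (S + Nc) ->
    `|corner_avg L1 L2 L3 f c - corner_avg L1 L2 L3 f x| <=
      d0 + T * (d1 + d3) + t * d2 ->
    K * (d0 + T * (d1 + d3) + t * d2) <= influence d0 d1 d2 d3 ->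
    Nc * `|corner_avg L1 L2 L3 f c - corner_avg L1 L2 L3 f x| <=
      influence d0 d1 d2 d3 * (S + Nc).
  move=> <- k0 hN hF hE; have SN : 0 <= S + Nc by rewrite addr_ge0 // ltW.
  apply: le_trans (ler_wpM2r SN hE); rewrite [_ * (S + Nc)]mulrAC.
  apply: ler_pM => //.
  by rewrite mulrAC ler_pdivlMr ?ltr0n // mulrC.
(* With share 0.246, K = 0.135, T = 0.301 and t = 1/3, the side coefficient is 0.246 (0.301 + 0.045)
   < 0.0865 and the opposite one 0.246 * 0.135 < 0.034. *)
have [cL|] := boolP ((c \in L1) || (c \in L3)).
  rewrite /theta1000 cL in theta; rewrite /kappa1000 cL in hK.
  apply: (main _ _ _ _ erefl _ theta (corner_avg_diff hL1 hL2 hL3 f0 f1 f2 f3 hK T1 T3 t1 t3)).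
    by rewrite divr_ge0.
  by rewrite -[N.to_nat 246]/246%N -[N.to_nat 135]/135%N /influence; lra.
rewrite negb_or => /andP[c1 c3].
rewrite /theta1000 (negPf c1) (negPf c3) in theta; rewrite /kappa1000 (negPf c1) (negPf c3) in hK.
have {}t1 z z' : #|L1 :\: [set z; z'; c]|.+1%:R^-1 <= 4^-1 :> R.
  by rewrite setUC setUA inv_card_le // card_setD3_ge3.
have {}t3 z z' : #|L3 :\: [set z; z'; c]|.+1%:R^-1 <= 4^-1 :> R.
  by rewrite setUC setUA inv_card_le // card_setD3_ge3.
have {}T1 := tau_frac_le4 L1 L2 L3 x hL1 c1.
have {}T3 := tau_frac_le4 L1 L2 L3 x hL3 c3.
(* With share 0.283, K = 0.112 and T = t = 1/4; this case fixes the coefficient of [d0]. *)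
apply: (main _ _ _ _ erefl _ theta (corner_avg_diff hL1 hL2 hL3 f0 f1 f2 f3 hK T1 T3 t1 t3)).
  by rewrite divr_ge0.
by rewrite -[N.to_nat 283]/283%N -[N.to_nat 112]/112%N /influence; lra.
Qed.
Lemma cycle_sum_rot L0 L1 L2 L3 f :
  cycle_sum L0 L1 L2 L3 f = cycle_sum L1 L2 L3 L0 (fun y z w x => f x y z w).
Proof.
rewrite /cycle_sum exchange_big; apply: eq_bigr => y _ /=.
rewrite exchange_big; apply: eq_bigr => z _ /=.
rewrite exchange_big; apply: eq_bigr => w _ /=; apply: eq_bigr => x _.
congr (_%:R * _); rewrite /cycle_ok.
case: (x \in L0); case: (y \in L1); case: (z \in L2); case: (w \in L3) => //=.
by case: (x != y); case: (y != z); case: (z != w); case: (w != x).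
Qed.

Lemma cycle_avg_rot L0 L1 L2 L3 f :
  cycle_avg L0 L1 L2 L3 f = cycle_avg L1 L2 L3 L0 (fun y z w x => f x y z w).
Proof. by rewrite /cycle_avg !(cycle_sum_rot L0 L1). Qed.

Lemma cycle_avg_dist L0 L1 L2 L3 f f' e : 0 <= e ->
  (forall x y z w, `|f x y z w - f' x y z w| <= e) ->
  `|cycle_avg L0 L1 L2 L3 f - cycle_avg L0 L1 L2 L3 f'| <= e.
Proof.
move=> e0 ff'; rewrite /cycle_avg -mulrBl normrM normfV.
set C := cycle_sum _ _ _ _ (fun _ _ _ _ => 1).
have C0 : 0 <= C by do 4 (apply: sumr_ge0 => ? _); rewrite mulr1 ler0n.
rewrite (ger0_norm C0).
suff H : `|cycle_sum L0 L1 L2 L3 f - cycle_sum L0 L1 L2 L3 f'| <= e * C.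
  (* Without any admissible colouring both averages are 0, by the convention for the inverse of
     0. *)
  have [->|Cn0] := eqVneq C 0; first by rewrite invr0 mulr0.
  by rewrite ler_pdivrMr // lt_def Cn0.
rewrite /C /cycle_sum mulr_sumr -sumrB; apply: (le_trans (ler_norm_sum _ _ _)).
apply: ler_sum => x _.
rewrite mulr_sumr -sumrB; apply: (le_trans (ler_norm_sum _ _ _)); apply: ler_sum => y _.
rewrite mulr_sumr -sumrB; apply: (le_trans (ler_norm_sum _ _ _)); apply: ler_sum => z _.
rewrite mulr_sumr -sumrB; apply: (le_trans (ler_norm_sum _ _ _)); apply: ler_sum => w _.
by rewrite -mulrBr normrM normr_nat mulr1 mulrC ler_wpM2r.
Qed.

(** The effect of recolouring one boundary vertex: at most one colour lost and one gained, with four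
    in common. *)
Definition close_lists L L' : bool :=
  [&& 4 <= #|L :&: L'|, #|L :\: L'| <= 1 & #|L' :\: L| <= 1]%N.

Section Hybrid.
Variables (L0 L1 L2 L3 L0' L1' L2' L3' : {set Q}) (b0 b1 b2 b3 : bool).
Variables (f : Q -> Q -> Q -> Q -> R) (d0 d1 d2 d3 : R).
Hypotheses (hL1 : (5 <= #|L1|)%N) (hL2 : (5 <= #|L2|)%N) (hL3 : (5 <= #|L3|)%N).
Hypotheses (hL0' : (5 <= #|L0'|)%N) (hL1' : (5 <= #|L1'|)%N) (hL2' : (5 <= #|L2'|)%N).
Hypotheses (n0 : close_lists L0 L0') (n1 : close_lists L1 L1').
Hypotheses (n2 : close_lists L2 L2') (n3 : close_lists L3 L3').
Hypotheses (e0 : ~~ b0 -> L0 = L0') (e1 : ~~ b1 -> L1 = L1').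
Hypotheses (e2 : ~~ b2 -> L2 = L2') (e3 : ~~ b3 -> L3 = L3').
Hypothesis f0 : forall x x' y z w, `|f x y z w - f x' y z w| <= d0.
Hypothesis f1 : forall x y y' z w, `|f x y z w - f x y' z w| <= d1.
Hypothesis f2 : forall x y z z' w, `|f x y z w - f x y z' w| <= d2.
Hypothesis f3 : forall x y z w w', `|f x y z w - f x y z w'| <= d3.

(** The lists are replaced one at a time, each rotated to the front. Several flags can be set at
    once: on a torus of width 3 an outside vertex is adjacent to two corners. *)
Lemma cycle_avg_hybrid :
  `|cycle_avg L0 L1 L2 L3 f - cycle_avg L0' L1' L2' L3' f| <=
  b0%:R * influence d0 d1 d2 d3 + b1%:R * influence d1 d2 d3 d0 +
  b2%:R * influence d2 d3 d0 d1 + b3%:R * influence d3 d0 d1 d2.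
Proof.
have -> : cycle_avg L0 L1 L2 L3 f - cycle_avg L0' L1' L2' L3' f =
  (cycle_avg L0 L1 L2 L3 f - cycle_avg L0' L1 L2 L3 f) +
  (cycle_avg L0' L1 L2 L3 f - cycle_avg L0' L1' L2 L3 f) +
  (cycle_avg L0' L1' L2 L3 f - cycle_avg L0' L1' L2' L3 f) +
  (cycle_avg L0' L1' L2' L3 f - cycle_avg L0' L1' L2' L3' f) by ring.
apply: (le_trans (ler_normD _ _)); apply: lerD.
  apply: (le_trans (ler_normD _ _)); apply: lerD.
    apply: (le_trans (ler_normD _ _)); apply: lerD.
    - case: b0 e0 => [_|->] //; last by rewrite subrr normr0 mul0r.
      by rewrite mul1r; case/and3P: n0 => *; apply: cycle_avg_change.
    - case: b1 e1 => [_|->] //; last by rewrite subrr normr0 mul0r.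
      rewrite mul1r !(cycle_avg_rot L0').
      by case/and3P: n1 => *; apply: cycle_avg_change.
  - case: b2 e2 => [_|->] //; last by rewrite subrr normr0 mul0r.
    rewrite mul1r !(cycle_avg_rot L0') !(cycle_avg_rot L1').
    by case/and3P: n2 => *; apply: cycle_avg_change.
- case: b3 e3 => [_|->] //; last by rewrite subrr normr0 mul0r.
  rewrite mul1r !(cycle_avg_rot L0') !(cycle_avg_rot L1') !(cycle_avg_rot L2').
  by case/and3P: n3 => *; apply: cycle_avg_change.
Qed.

End Hybrid.
End Cycle.

From mathcomp Require Import all_classical all_reals all_analysis.

Import Order.TTheory GRing.Theory Num.Theory.

(** * Block updates *)

Section Operators.
Variables (R : realType) (T : finType).

(** The Markov operator: the expectation of f after one step from s. *)
Definition mx_apply (P : 'M[R]_#|T|) (f : T -> R) (s : T) : R :=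
  \sum_x P (enum_rank s) (enum_rank x) * f x.

Lemma mx_applyM (P P' : 'M[R]_#|T|) f s :
  mx_apply (P * P') f s = mx_apply P (mx_apply P' f) s.
Proof.
rewrite /mx_apply; under eq_bigr => x _ do rewrite -mulmxE mxE mulr_suml.
rewrite exchange_big /= (reindex enum_rank) /=; last exact: onW_bij (enum_rank_bij T).
by apply: eq_bigr => y _; rewrite mulr_sumr; apply: eq_bigr => x _; rewrite mulrA.
Qed.

Lemma mx_apply1 f s : mx_apply 1 f s = f s.
Proof.
rewrite /mx_apply (bigD1 s) //= big1 => [|x xs]; rewrite mxE (inj_eq enum_rank_inj).
  by rewrite eqxx mul1r addr0.
by rewrite eq_sym (negPf xs) mul0r.
Qed.
End Operators.

Section Block.
Variables (R : realType) (V : finType) (e : rel V) (v0 v1 v2 v3 : V).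
Local Notation Q := 'I_7.
Let B : {set V} := [set v0; v1; v2; v3]%SET.
Hypothesis v_uniq : uniq [:: v0; v1; v2; v3].
Hypothesis e_sym : symmetric e.
Hypothesis e_cycle : [&& e v0 v1, e v1 v2, e v2 v3 & e v3 v0].
Hypothesis e_irr : irreflexive e.
Hypothesis e_diag : ~~ e v0 v2 /\ ~~ e v1 v3.

Definition outer_nbrs (C : {set V}) (v : V) : {set V} := [set u | (u \notin C) && e v u]%SET.

Definition allowed (C : {set V}) (s : colouring V) (v : V) : {set Q} :=
  [set q | [forall u in outer_nbrs C v, q != s u]]%SET.

Definition fill (s : colouring V) (x y z w : Q) : colouring V :=
  [ffun v => if v == v0 then x else if v == v1 then y else
             if v == v2 then z else if v == v3 then w else s v].

Lemma fillE s x y z w :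
  [/\ fill s x y z w v0 = x, fill s x y z w v1 = y, fill s x y z w v2 = z,
      fill s x y z w v3 = w & forall v, v \notin B -> fill s x y z w v = s v].
Proof.
move: v_uniq; rewrite /= !inE !negb_or -!andbA => /and5P[h01 h02 h03 h12 /andP[h13 /andP[h23 _]]].
split=> [||||v]; rewrite ffunE ?eqxx //.
- by rewrite eq_sym (negPf h01).
- by rewrite eq_sym (negPf h02) eq_sym (negPf h12).
- by rewrite eq_sym (negPf h03) eq_sym (negPf h13) eq_sym (negPf h23).
by rewrite !inE !negb_or -!andbA => /and4P[/negPf-> /negPf-> /negPf-> /negPf->].
Qed.

(** As the block has no diagonal edges, its inner constraints are exactly those of the 4-cycle, and
    the boundary acts only through the lists. *)
Lemma fill_heat_bath s x y z w :
  (fill s x y z w \in heat_bath_set e B s) =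
  cycle_ok (allowed B s v0) (allowed B s v1) (allowed B s v2) (allowed B s v3) x y z w.
Proof.
have [F0 F1 F2 F3 FB] := fillE s x y z w; set F := fill _ _ _ _ _ in F0 F1 F2 F3 FB *.
rewrite inE.
have -> : [forall v, (v \notin B) ==> (F v == s v)].
  by apply/forallP => v; apply/implyP => /FB ->.
have -> : [forall u in B, forall v in B, e u v ==> (F u != F v)] =
  [&& x != y, y != z, z != w & w != x].
  have /and4P[e01 e12 e23 e30] := e_cycle; have [e02 e13] := e_diag.
  apply/idP/idP => [/forall_inP H|/and4P[xy yz zw wx]].
    have {}H u v : u \in B -> v \in B -> e u v -> F u != F v.
      by move=> uB vB; apply/implyP; move: (H u uB) => /forall_inP; apply.
    by rewrite -F0 -F1 -F2 -F3 !H // !inE eqxx ?orbT.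
  apply/forall_inP => u uB; apply/forall_inP => v vB; apply/implyP.
  move: uB vB; rewrite !inE -!orbA => /or4P[] /eqP-> /or4P[] /eqP->;
    rewrite ?e_irr ?[e v2 v0]e_sym ?[e v3 v1]e_sym ?(negPf e02) ?(negPf e13) //
      ?F0 ?F1 ?F2 ?F3 => _ //; rewrite eq_sym //.
have -> : [forall u in B, forall v in block_boundary e B, e u v ==> (F u != s v)] =
  [&& x \in allowed B s v0, y \in allowed B s v1, z \in allowed B s v2 & w \in allowed B s v3].
  have P u q : u \in B -> F u = q ->
    [forall v in block_boundary e B, e u v ==> (F u != s v)] = (q \in allowed B s u).
    move=> uB <-; rewrite inE; apply/forall_inP/forall_inP => H v.
      rewrite inE => /andP[vB euv]; have vbd : v \in block_boundary e B.
        by rewrite inE vB /=; apply/exists_inP; exists u; rewrite // e_sym.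
      by have /implyP := H v vbd; apply.
    rewrite inE => /andP[vB _]; apply/implyP => euv.
    by apply: H; rewrite inE vB.
  have B0 : v0 \in B by rewrite !inE eqxx.
  have B1 : v1 \in B by rewrite !inE eqxx ?orbT.
  have B2 : v2 \in B by rewrite !inE eqxx ?orbT.
  have B3 : v3 \in B by rewrite !inE eqxx ?orbT.
  rewrite -(P _ _ B0 F0) -(P _ _ B1 F1) -(P _ _ B2 F2) -(P _ _ B3 F3).
  apply/forall_inP/and4P => [H|[H0 H1 H2 H3] u]; first by split; apply: H.
  by rewrite !inE -!orbA => /or4P[] /eqP->.
by rewrite andTb andbC.
Qed.

Lemma sum_heat_bath s (g : colouring V -> R) :
  \sum_(s' in heat_bath_set e B s) g s' =
  cycle_sum (allowed B s v0) (allowed B s v1) (allowed B s v2) (allowed B s v3)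
    (fun x y z w => g (fill s x y z w)).
Proof.
rewrite /cycle_sum !pair_bigA /=.
rewrite (reindex_onto (fun t : Q * Q * Q * Q => fill s t.1.1.1 t.1.1.2 t.1.2 t.2)
  (fun s' : colouring V => (s' v0, s' v1, s' v2, s' v3))) /=.
  rewrite big_mkcond; apply: eq_bigr => -[[[x y] z] w] _ /=.
  have [-> -> -> -> _] := fillE s x y z w; rewrite eqxx andbT fill_heat_bath.
  by case: cycle_ok; rewrite ?mul1r ?mul0r.
move=> s'; rewrite inE => /andP[/forallP H _].
have [F0 F1 F2 F3 FB] := fillE s (s' v0) (s' v1) (s' v2) (s' v3).
apply/ffunP => v; have [|vB] := boolP (v \in B); last first.
  by rewrite FB //; apply/esym/eqP; have /implyP := H v; apply.
by rewrite !inE -!orbA => /or4P[] /eqP->; rewrite ?F0 ?F1 ?F2 ?F3.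
Qed.

Lemma block_updateE f s : mx_apply (block_update R e B) f s =
  cycle_avg (allowed B s v0) (allowed B s v1) (allowed B s v2) (allowed B s v3)
    (fun x y z w => f (fill s x y z w)).
Proof.
have C := sum_heat_bath s (fun=> 1); rewrite sumr_const in C.
rewrite /cycle_avg -C -sum_heat_bath /mx_apply.
rewrite [in RHS]mulr_suml [RHS]big_mkcond; apply: eq_bigr => s' _.
rewrite mxE !enum_rankK /uniform_dist; case: ifP => _; rewrite ?mul0r // mul1r mulrC //.
Qed.

End Block.

(** * Oscillation of functions of a colouring *)

Section Oscillation.
Variables (R : realType) (V : finType) (e : rel V).
Implicit Types (f : colouring V -> R) (d : V -> R).

(** Any upper bound d on the oscillations is allowed, so bounds can be passed through successive
    updates. *)
Definition osc_le f d : Prop :=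
  forall i (s t : colouring V), (forall j, j != i -> s j = t j) -> `|f s - f t| <= d i.

Lemma osc_le_ge0 f d i : osc_le f d -> 0 <= d i.
Proof. by move=> fd; apply: le_trans (fd i [ffun=> ord0] [ffun=> ord0] _). Qed.

(* The free weights [c] make the property composable: with [c i := 49/50] on the vertices that the
   blocks updated earlier will cover, oscillation moved out of [C] is discounted only once. *)
Definition contracts (P : 'M[R]_#|colouring V|) (C : {set V}) : Prop :=
  forall f d, osc_le f d -> exists2 d', osc_le (mx_apply P f) d' &
    forall c : V -> R, (forall i, 0 <= c i <= 1) ->
      \sum_i c i * d' i <= \sum_i (if i \in C then 49 / 50 else c i) * d i.

(** * Colour lists determined by the boundary *)

Section Allowed.
Variable C : {set V}.
Hypothesis deg : forall v, v \in C -> (#|outer_nbrs e C v| <= 2)%N.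

Lemma allowedP (s : colouring V) v q :
  reflect (exists2 u, u \in outer_nbrs e C v & q = s u) (q \notin allowed e C s v).
Proof.
rewrite inE negb_forall_in; apply: (iffP exists_inP) => -[u uN].
  by rewrite negbK => /eqP ->; exists u.
by move=> ->; exists u; rewrite ?negbK.
Qed.

(** Each of at most two outside neighbours forbids one colour out of seven. *)
Lemma card_allowed (s : colouring V) v : v \in C -> (5 <= #|allowed e C s v|)%N.
Proof.
move=> vC; have h2 : (#|~: allowed e C s v| <= 2)%N.
  apply: leq_trans (deg vC); apply: leq_trans (leq_imset_card s _).
  apply: subset_leq_card; apply/fintype.subsetP => q; rewrite inE => /allowedP[u uN ->].
  exact: imset_f.
have := cardsC (allowed e C s v); rewrite card_ord => h.
by rewrite -(leq_add2r #|~: allowed e C s v|) h -[7%N]/(5 + 2)%N leq_add2l.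
Qed.

Variables (s t : colouring V) (i : V).
Hypothesis st : forall j, j != i -> s j = t j.

Lemma allowed_eq v : i \notin outer_nbrs e C v -> allowed e C s v = allowed e C t v.
Proof.
move=> iN; apply/setP => q; rewrite !inE; apply: eq_forallb_in => u uN.
by rewrite st //; apply: contraNneq iN => <-.
Qed.

Lemma allowed_near v : v \in C -> close_lists (allowed e C s v) (allowed e C t v).
Proof.
move=> vC; have sub q : q \notin allowed e C t v -> q = t i \/ q \notin allowed e C s v.
  case/allowedP => u uN ->; have [->|ui] := eqVneq u i; first by left.
  by right; apply/allowedP; exists u; rewrite ?st.
have sub' q : q \notin allowed e C s v -> q = s i \/ q \notin allowed e C t v.
  case/allowedP => u uN ->; have [->|ui] := eqVneq u i; first by left.
  by right; apply/allowedP; exists u; rewrite ?st.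
apply/and3P; split.
- have := cardsC (allowed e C s v :&: allowed e C t v); rewrite card_ord => h.
  rewrite -(leq_add2r #|~: (allowed e C s v :&: allowed e C t v)|) h -[7%N]/(4 + 3)%N leq_add2l.
  (* A colour outside the common part is [t i] or one of the at most two forbidden under s. *)
  apply: (@leq_trans #|t i |: ~: allowed e C s v|).
    apply: subset_leq_card; apply/fintype.subsetP => q.
    rewrite finset.in_setC finset.in_setI negb_and finset.in_setU1 finset.in_setC.
    by case/orP => [->|/sub[->|->]]; rewrite ?eqxx ?orbT.
  have := card_allowed s vC; have := cardsC (allowed e C s v); rewrite card_ord => h' h5.
  rewrite cardsU1 -[3%N]/(1 + 2)%N leq_add //; first by case: (_ \notin _).
  by rewrite -(leq_add2l #|allowed e C s v|) h' -[7%N]/(5 + 2)%N leq_add2r.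
- apply: (@leq_trans #|[set t i]|); last by rewrite cards1.
  apply: subset_leq_card; apply/fintype.subsetP => q.
  by rewrite finset.in_setD finset.in_set1 => /andP[/sub[-> //|/negPf->]].
- apply: (@leq_trans #|[set s i]|); last by rewrite cards1.
  apply: subset_leq_card; apply/fintype.subsetP => q.
  by rewrite finset.in_setD finset.in_set1 => /andP[/sub'[-> //|/negPf->]].
Qed.

End Allowed.

Section BlockContracts.
Variables (v0 v1 v2 v3 : V).
Let B : {set V} := [set v0; v1; v2; v3]%SET.
Hypothesis v_uniq : uniq [:: v0; v1; v2; v3].
Hypothesis e_sym : symmetric e.
Hypothesis e_cycle : [&& e v0 v1, e v1 v2, e v2 v3 & e v3 v0].
Hypothesis e_irr : irreflexive e.
Hypothesis e_diag : ~~ e v0 v2 /\ ~~ e v1 v3.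
Hypothesis deg : forall v, v \in B -> (#|outer_nbrs e B v| <= 2)%N.

(** An outside vertex keeps its own oscillation and receives the influence of each adjacent corner;
    block vertices get 0, because their old colours are overwritten. *)
Definition block_osc d i : R :=
  (i \notin B)%:R * d i +
  ((i \in outer_nbrs e B v0)%:R * influence (d v0) (d v1) (d v2) (d v3) +
   (i \in outer_nbrs e B v1)%:R * influence (d v1) (d v2) (d v3) (d v0) +
   (i \in outer_nbrs e B v2)%:R * influence (d v2) (d v3) (d v0) (d v1) +
   (i \in outer_nbrs e B v3)%:R * influence (d v3) (d v0) (d v1) (d v2)).

Lemma block_osc_le f d : osc_le f d ->
  osc_le (mx_apply (block_update R e B) f) (block_osc d).
Proof.
move=> fd i s t st.
have h5 u v : v \in B -> (5 <= #|allowed e B u v|)%N by apply: card_allowed.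
have B0 : v0 \in B by rewrite !inE eqxx.
have B1 : v1 \in B by rewrite !inE eqxx ?orbT.
have B2 : v2 \in B by rewrite !inE eqxx ?orbT.
have B3 : v3 \in B by rewrite !inE eqxx ?orbT.
rewrite !(block_updateE v_uniq e_sym e_cycle e_irr e_diag).
set Fs := (fun x y z w => f (fill _ _ _ _ s x y z w)).
set Ft := (fun x y z w => f (fill _ _ _ _ t x y z w)).
set As := allowed e B s; set At := allowed e B t.
(* The outside colour read by f changes first, then the lists. *)
have -> : cycle_avg (As v0) (As v1) (As v2) (As v3) Fs -
          cycle_avg (At v0) (At v1) (At v2) (At v3) Ft =
  (cycle_avg (As v0) (As v1) (As v2) (As v3) Fs -
   cycle_avg (As v0) (As v1) (As v2) (As v3) Ft) +
  (cycle_avg (As v0) (As v1) (As v2) (As v3) Ft -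
   cycle_avg (At v0) (At v1) (At v2) (At v3) Ft) by ring.
apply: (le_trans (ler_normD _ _)); apply: lerD.
  apply: cycle_avg_dist; first by rewrite mulr_ge0 // (osc_le_ge0 _ fd).
  move=> x y z w; rewrite /Fs /Ft; have [iB|iB] := boolP (i \in B); last first.
    rewrite mul1r; apply: fd => j ji; rewrite !ffunE st //.
  suff -> : fill v0 v1 v2 v3 s x y z w = fill v0 v1 v2 v3 t x y z w by rewrite subrr normr0 mul0r.
  apply/ffunP => j; rewrite !ffunE; have [jB|jB] := boolP (j \in B).
    by move: jB; rewrite !inE -!orbA => /or4P[] /eqP->; rewrite eqxx //; do ?case: ifP.
  by rewrite st //; apply: contraNneq jB => ->.
apply: cycle_avg_hybrid; rewrite ?h5 //; try (by apply: allowed_eq);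
  try (by apply: (allowed_near deg st)).
- by move=> x x' y z w; apply: fd => j /negPf ji; rewrite !ffunE ji.
- by move=> x y y' z w; apply: fd => j /negPf ji; rewrite !ffunE ji.
- by move=> x y z z' w; apply: fd => j /negPf ji; rewrite !ffunE ji.
- by move=> x y z w w'; apply: fd => j /negPf ji; rewrite !ffunE ji.
Qed.

Lemma block_contracts : contracts (block_update R e B) B.
Proof.
move=> f d fd; exists (block_osc d); first exact: block_osc_le.
have d0 v : 0 <= d v := osc_le_ge0 v fd.
move=> c c01.
have nbr v x : v \in B -> 0 <= x -> \sum_i c i * ((i \in outer_nbrs e B v)%:R * x) <= 2 * x.
  move=> vB x0; apply: (@le_trans _ _ (\sum_i (i \in outer_nbrs e B v)%:R * x)).
    apply: ler_sum => i _; have /andP[c0 c1] := c01 i.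
    by rewrite ler_piMl // mulr_ge0.
  rewrite -mulr_suml ler_wpM2r // -natr_sum ler_nat.
  apply: leq_trans (deg vB); rewrite -sum1_card [leqRHS]big_mkcond.
  by apply: leq_sum => i _; case: (i \in _).
have B0 : v0 \in B by rewrite !inE eqxx.
have B1 : v1 \in B by rewrite !inE eqxx ?orbT.
have B2 : v2 \in B by rewrite !inE eqxx ?orbT.
have B3 : v3 \in B by rewrite !inE eqxx ?orbT.
have inf0 x y z w : 0 <= influence (d x) (d y) (d z) (d w).
  by have := d0 x; have := d0 y; have := d0 z; have := d0 w; rewrite /influence; lra.
have splitE (a b0 b1 b2 b3 : V -> R) I0 I1 I2 I3 :
    \sum_i c i * (a i + (b0 i * I0 + b1 i * I1 + b2 i * I2 + b3 i * I3)) =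
    \sum_i c i * a i + (\sum_i c i * (b0 i * I0) + \sum_i c i * (b1 i * I1) +
      \sum_i c i * (b2 i * I2) + \sum_i c i * (b3 i * I3)).
  by rewrite -!big_split; apply: eq_bigr => i _; rewrite !mulrDr.
rewrite /block_osc splitE.
rewrite [leRHS](bigID (mem B)) /=.
have -> : \sum_(i in B) (if i \in B then 49 / 50 else c i) * d i =
  49 / 50 * (d v0 + d v1 + d v2 + d v3).
  under eq_bigr => i iB do rewrite iB.
  rewrite -mulr_sumr; congr (_ * _).
  rewrite (eq_bigl (mem [:: v0; v1; v2; v3])); last by move=> i; rewrite !inE -!orbA.
  by rewrite -big_uniq //= !big_cons big_nil addr0 !addrA.
have -> : \sum_(i | i \notin B) (if i \in B then 49 / 50 else c i) * d i =
  \sum_i c i * ((i \notin B)%:R * d i).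
  rewrite big_mkcond; apply: eq_bigr => i _.
  by case: (i \in B); rewrite ?mul1r ?mul0r ?mulr0.
rewrite [leRHS]addrC lerD2l.
have := nbr _ _ B0 (inf0 v0 v1 v2 v3); have := nbr _ _ B1 (inf0 v1 v2 v3 v0).
have := nbr _ _ B2 (inf0 v2 v3 v0 v1); have := nbr _ _ B3 (inf0 v3 v0 v1 v2).
(* Each corner enters all four influences, each counted at most twice: 2 (0.283 + 2 * 0.0865 +
   0.034) = 49/50. *)
rewrite /influence; lra.
Qed.

End BlockContracts.
End Oscillation.

(** * Mixing of systematic scan *)

Section Mixing.
Variables (R : realType) (V : finType) (e : rel V).
Implicit Types (f : colouring V -> R) (d : V -> R) (P : 'M[R]_#|colouring V|).

(** On functions the last block acts first, so the tail is handled by induction and the head last.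
    The weights the head leaves, 49/50 on B and c elsewhere, are fed to the tail. *)
Lemma scan_contracts (Bs : seq {set V}) :
  (forall B, B \in Bs -> contracts (block_update R e B) B) ->
  contracts (systematic_scan R e Bs) (\bigcup_(B <- Bs) B)%SET.
Proof.
elim: Bs => [_|B Bs IH H] f d fd.
  exists d; first by move=> i s t st; rewrite /systematic_scan big_nil !mx_apply1; apply: fd.
  by move=> c _; under [leRHS]eq_bigr do rewrite big_nil finset.in_set0.
have {}IH : contracts (systematic_scan R e Bs) (\bigcup_(B <- Bs) B)%SET.
  by apply: IH => C CB; apply: H; rewrite inE CB orbT.
have [d1 d1P d1S] := IH f d fd.
have [d2 d2P d2S] := H B (mem_head _ _) _ _ d1P.
exists d2.
  by move=> i s t st; rewrite /systematic_scan big_cons !mx_applyM; apply: d2P.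
move=> c c01; apply: (le_trans (d2S c c01)); apply: (le_trans (d1S _ _)).
  by move=> i; case: ifP => // _; apply/andP; split; lra.
apply: ler_sum => i _; rewrite big_cons finset.in_setU.
by case: (i \in B); case: (i \in _).
Qed.

Lemma expr_contracts P f d t : contracts P [set: V]%SET -> osc_le f d ->
  exists2 d', osc_le (mx_apply (P ^+ t) f) d' & \sum_i d' i <= (49 / 50) ^+ t * \sum_i d i.
Proof.
move=> PC fd; elim: t => [|t [d1 d1P d1S]].
  exists d; last by rewrite expr0 mul1r.
  by move=> i s s' ss'; rewrite expr0 !mx_apply1; apply: fd.
have [d2 d2P d2S] := PC _ _ d1P; exists d2.
  by move=> i s s' ss'; rewrite exprS !mx_applyM; apply: d2P.
have -> : \sum_i d2 i = \sum_i 1 * d2 i by apply: eq_bigr => i _; rewrite mul1r.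
apply: le_trans (d2S (fun=> 1) _) _; first by move=> i; rewrite ler01 lexx.
under eq_bigr => i _ do rewrite finset.in_setT.
by rewrite -mulr_sumr exprS -[leRHS]mulrA ler_wpM2l // divr_ge0.
Qed.

(** Move from s to t one vertex at a time. *)
Lemma osc_le_sum f d s t : osc_le f d -> `|f s - f t| <= \sum_i d i.
Proof.
move=> fd; pose u (l : seq V) : colouring V := [ffun v => if v \in l then t v else s v].
have H (l : seq V) : `|f s - f (u l)| <= \sum_(i <- l) d i.
  elim: l => [|i l IH].
    suff -> : u [::] = s by rewrite subrr normr0 big_nil.
    by apply/ffunP => v; rewrite ffunE.
  rewrite big_cons.
  have -> : f s - f (u (i :: l)) = (f (u l) - f (u (i :: l))) + (f s - f (u l)) by ring.
  apply: (le_trans (ler_normD _ _)); apply: lerD => //; apply: fd => j ji.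
  by rewrite !ffunE inE (negPf ji).
have := H (index_enum V); suff -> : u (index_enum V) = t by [].
by apply/ffunP => v; rewrite ffunE mem_index_enum.
Qed.

(** Stationarity in dual form, tested against functions, to match [mx_apply]. *)
Definition stationary (p : colouring V -> R) P : Prop :=
  forall f, \sum_s p s * mx_apply P f s = \sum_s p s * f s.

Lemma stationary_expr p P t : stationary p P -> stationary p (P ^+ t).
Proof.
move=> pP; elim: t => [|t IH] f.
  by rewrite expr0; apply: eq_bigr => s _; rewrite mx_apply1.
by rewrite exprS; under eq_bigr do rewrite mx_applyM; rewrite pP IH.
Qed.

Lemma heat_bath_set_eq (B : {set V}) (s s' : colouring V) :
  (forall v, v \notin B -> s v = s' v) -> heat_bath_set e B s = heat_bath_set e B s'.
Proof.
move=> ss'; apply/setP => x; rewrite !inE; congr [&& _, _ & _].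
  by apply: eq_forallb => v; have [//|vB] := boolP (v \in B); rewrite ss'.
apply: eq_forallb_in => u uB; apply: eq_forallb_in => v.
by rewrite inE => /andP[vB _]; rewrite ss'.
Qed.

Hypothesis e_sym : symmetric e.

(** Properness is preserved and two proper colourings reachable from each other share one heat-bath
    set; detailed balance rests on this. *)
Lemma heat_bath_set_proper (B : {set V}) (s s' : colouring V) :
  s \in proper_colourings e -> s' \in heat_bath_set e B s ->
  [/\ s' \in proper_colourings e, s \in heat_bath_set e B s' &
      heat_bath_set e B s' = heat_bath_set e B s].
Proof.
rewrite !inE => /forallP sP /and3P[/forallP h1 /forall_inP h2 /forall_inP h3].
have sP' u v : e u v -> s u != s v by move: (sP u) => /forallP/(_ v)/implyP.
have off v : v \notin B -> s' v = s v by move=> vB; apply/eqP; have /implyP := h1 v; apply.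
have hin u v : u \in B -> v \in B -> e u v -> s' u != s' v.
  by move=> uB vB; apply/implyP; move: (h2 u uB) => /forall_inP; apply.
have hbd u v : u \in B -> v \notin B -> e u v -> s' u != s v.
  move=> uB vB euv; have /forall_inP/(_ v) := h3 u uB; rewrite euv; apply.
  by rewrite inE vB; apply/exists_inP; exists u; rewrite // e_sym.
split; last by apply: heat_bath_set_eq.
  apply/forallP => u; apply/forallP => v; apply/implyP => euv.
  have [uB|uB] := boolP (u \in B); have [vB|vB] := boolP (v \in B).
  - exact: hin.
  - by rewrite (off v vB); apply: hbd.
  - by rewrite (off u uB) eq_sym; apply: hbd; rewrite // e_sym.
  - by rewrite !off //; apply: sP'.
apply/and3P; split.
- by apply/forallP => v; apply/implyP => vB; rewrite off.
- by apply/forall_inP => u _; apply/forall_inP => v _; apply/implyP; apply: sP'.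
- apply/forall_inP => u _; apply/forall_inP => v; rewrite inE => /andP[vB _].
  by apply/implyP; rewrite off //; apply: sP'.
Qed.

Lemma heat_bath_set_self (B : {set V}) (s : colouring V) :
  s \in proper_colourings e -> s \in heat_bath_set e B s.
Proof.
rewrite !inE => /forallP sP.
have sP' u v : e u v ==> (s u != s v) by move: (sP u) => /forallP/(_ v).
apply/and3P; split; first by apply/forallP => v; rewrite eqxx implybT.
  by apply/forall_inP => u _; apply/forall_inP => v _; apply: sP'.
by apply/forall_inP => u _; apply/forall_inP => v _; apply: sP'.
Qed.

Let pi := uniform_dist R (proper_colourings e).

(** Detailed balance: when either flow is nonzero, both colourings are proper and have the same
    heat-bath set. *)
Lemma block_update_stationary B : stationary pi (block_update R e B).
Proof.
move=> f; have bal s s' : pi s * uniform_dist R (heat_bath_set e B s) s' =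
    pi s' * uniform_dist R (heat_bath_set e B s') s.
  wlog suff H : s s' / s \in proper_colourings e -> s' \in heat_bath_set e B s ->
    pi s * uniform_dist R (heat_bath_set e B s) s' =
    pi s' * uniform_dist R (heat_bath_set e B s') s.
    rewrite /pi /uniform_dist.
    have [sO|sO] := boolP (s \in proper_colourings e);
    have [s'O|s'O] := boolP (s' \in proper_colourings e); rewrite ?mul0r //.
    + have [h|h] := boolP (s' \in heat_bath_set e B s).
        by have := H _ _ sO h; rewrite /pi /uniform_dist sO s'O h.
      have [h'|h'] := boolP (s \in heat_bath_set e B s'); last by rewrite !mul0r.
      by have [_ h''] := heat_bath_set_proper s'O h'; rewrite h'' in h.
    + have [h|h] := boolP (s' \in heat_bath_set e B s); last by rewrite !mul0r mulr0.
      by have [h'] := heat_bath_set_proper sO h; rewrite h' in s'O.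
    + have [h|h] := boolP (s \in heat_bath_set e B s'); last by rewrite !mul0r mulr0.
      by have [h'] := heat_bath_set_proper s'O h; rewrite h' in sO.
  move=> sO h; have [s'O h' ->] := heat_bath_set_proper sO h.
  by rewrite /pi /uniform_dist sO s'O h heat_bath_set_self.
rewrite /mx_apply.
under eq_bigr => s _ do under eq_bigr => s' _ do rewrite mxE !enum_rankK.
under eq_bigr => s _ do rewrite mulr_sumr.
rewrite exchange_big; apply: eq_bigr => s' _ /=.
under eq_bigr => s _ do rewrite mulrA bal mulrAC.
rewrite -mulr_sumr /pi {1 3}/uniform_dist.
have [s'O|] := boolP (s' \in proper_colourings e); last by rewrite !mul0r.
(* The row of a proper s' sums to 1, its heat-bath set containing s' itself. *)
rewrite [X in _ * X](_ : _ = 1) ?mulr1 //.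
rewrite -mulr_suml -natr_sum -[X in X%:R / _](_ : #|heat_bath_set e B s'| = _); last first.
  by rewrite -sum1_card big_mkcond; apply: eq_bigr => s _; case: (_ \in _).
rewrite divff // pnatr_eq0 -lt0n; apply/card_gt0P; exists s'; exact: heat_bath_set_self.
Qed.

Lemma scan_stationary Bs : stationary pi (systematic_scan R e Bs).
Proof.
rewrite /systematic_scan; elim: Bs => [|B Bs IH] f.
  by rewrite big_nil; apply: eq_bigr => s _; rewrite mx_apply1.
rewrite big_cons -[RHS]IH -[RHS](block_update_stationary B).
by apply: eq_bigr => s _; rewrite mx_applyM.
Qed.

(** Half the sign of the difference of the two laws is a test function attaining the total variation
    distance, with oscillation at most 1 at each vertex. By stationarity the distance is a mean of
    differences of P f, which the contraction bounds. *)
Lemma dTV_scan_le Bs t s : proper_colourings e != finset.set0 ->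
  contracts (systematic_scan R e Bs) [set: V]%SET ->
  dTV (markov_row (systematic_scan R e Bs ^+ t) s) pi <= #|V|%:R * (49 / 50) ^+ t.
Proof.
move=> O0 PC; set P := systematic_scan R e Bs ^+ t.
pose p x := markov_row P s x - pi x; pose f x := 2^-1 * Num.sg (p x).
have fd : osc_le f (fun=> 1).
  move=> i x y _; rewrite /f -mulrBr.
  have sg1 (z : R) : -1 <= Num.sg z <= 1 by case: sgrP => _; apply/andP; split; lra.
  have /andP[? ?] := sg1 (p x); have /andP[? ?] := sg1 (p y).
  by rewrite ler_norml; apply/andP; split; lra.
have [d' d'P d'S] := expr_contracts t PC fd.
have pi1 : \sum_x pi x = 1.
  rewrite /pi /uniform_dist -mulr_suml -natr_sum.
  have -> : (\sum_(i : colouring V) (i \in proper_colourings e) = #|proper_colourings e|)%N.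
    by rewrite -sum1_card [RHS]big_mkcond; apply: eq_bigr => x _; case: (_ \in _).
  by rewrite divff // pnatr_eq0 cards_eq0.
have -> : dTV (markov_row P s) pi = \sum_x pi x * (mx_apply P f s - mx_apply P f x).
  rewrite /dTV; under [RHS]eq_bigr => x _ do rewrite mulrBr.
  rewrite sumrB -mulr_suml pi1 mul1r stationary_expr; last exact: scan_stationary.
  rewrite /mx_apply -sumrB mulr_sumr; apply: eq_bigr => x _.
  by rewrite -mulrBl -/(p x) /f mulrCA [p x * _]mulrC -normrEsg.
apply: le_trans (ler_norm _) _; apply: le_trans (ler_norm_sum _ _ _) _.
have pi0 x : 0 <= pi x by rewrite divr_ge0.
apply: (@le_trans _ _ (\sum_x pi x * \sum_i d' i)).
  apply: ler_sum => x _; rewrite normrM (ger0_norm (pi0 x)) ler_wpM2l //.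
  exact: osc_le_sum.
rewrite -mulr_suml pi1 mul1r; apply: (le_trans d'S).
by rewrite sumr_const mulrC.
Qed.

End Mixing.

(** * The toroidal grid *)

(** Take t as the integer part of 63 L. Since 49/50 <= exp(-1/50), it is enough that t >= 50 L, and
    t > 63 L - 1 >= 50 L once 13 L >= 1. *)
Lemma decay_le (R : realType) (n eps : R) : 4 <= n -> 0 < eps -> eps < 1 ->
  exists t : nat, [/\ (0 < t)%N, t%:R <= 63 * ln (n * eps^-1) & n * (49 / 50) ^+ t <= eps].
Proof.
move=> n4 e0 e1; set L := ln _.
have n0 : 0 < n by apply: lt_le_trans n4.
have x4 : 4 <= n * eps^-1.
  by apply: (le_trans n4); rewrite ler_peMr ?(ltW n0) // invf_ge1 // ltW.
have x0 : 0 < n * eps^-1 by apply: lt_le_trans x4.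
(* From ln(1/u) <= 1/u - 1 at u = n / eps >= 4. *)
have L34 : 3 / 4 <= L.
  have : ln ((n * eps^-1)^-1) <= (n * eps^-1)^-1 - 1.
    by rewrite -{1}(subrKC 1 (n * eps^-1)^-1) le_ln1Dx // ltrBrDl subrr invr_gt0.
  have : (n * eps^-1)^-1 <= 4^-1 by rewrite lef_pV2 ?posrE.
  by rewrite lnV ?posrE // -/L; lra.
have L0 : 0 <= 63 * L by lra.
have /andP[] := truncn_itv L0; set t := Num.trunc _ => tL Lt.
rewrite -natr1 in Lt.
exists t; split => //.
  by rewrite -(ltr_nat R) ; lra.
have aexp : (49 / 50 : R) <= expR (- 50^-1).
  by apply: le_trans (expR_ge1Dx _); lra.
have nE : n = eps * expR L by rewrite lnK ?posrE // mulrCA divff ?mulr1 // gt_eqF.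
rewrite [leRHS](_ : eps = n * expR (- L)); last first.
  by rewrite nE -mulrA -expRD subrr expR0 mulr1.
rewrite ler_pM2l //; apply: (@le_trans _ _ (expR (- 50^-1) ^+ t)).
  by rewrite lerXn2r // nnegrE ?divr_ge0 ?expR_ge0.
by rewrite -expRM_natl ler_expR; lra.
Qed.

Section Grid.
Variables (a b : nat).
Local Notation e := (@grid_adj a b).

Lemma grid_adjP (u v : grid a b) :
  reflect [\/ v = (u.1 + 1, u.2), v = (u.1 - 1, u.2), v = (u.1, u.2 + 1) | v = (u.1, u.2 - 1)]
          (e u v).
Proof.
rewrite /grid_adj !inE; apply: (iffP or4P) => -[/eqP h|/eqP h|/eqP h|/eqP h]; try by
  [constructor 1|constructor 2|constructor 3|constructor 4].
Qed.

Lemma grid_adj_sym : symmetric e.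
Proof.
suff H u v : e u v -> e v u by move=> u v; apply/idP/idP; apply: H.
case: u v => [x y] [x' y'] /grid_adjP[] [-> ->]; apply/grid_adjP => /=.
- by constructor 2; rewrite addrK.
- by constructor 1; rewrite subrK.
- by constructor 4; rewrite addrK.
- by constructor 3; rewrite subrK.
Qed.

(** ['Z_n] has at least two elements for every n, so 1 is nonzero in it. *)
Lemma addr1_neq n (x : 'Z_n) : (x + 1 == x) = false.
Proof. by rewrite -[X in _ == X]addr0 (inj_eq (addrI x)) oner_eq0. Qed.

Lemma subr1_neq n (x : 'Z_n) : (x - 1 == x) = false.
Proof. by rewrite subr_eq eq_sym addr1_neq. Qed.

Lemma grid_adj_irr : irreflexive e.
Proof.
move=> [x y]; rewrite /grid_adj !inE !xpair_eqE !eqxx /= ![x == _]eq_sym ![y == _]eq_sym.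
by rewrite !addr1_neq !subr1_neq.
Qed.

Variables (x : 'Z_a) (y : 'Z_b).
Let v0 : grid a b := (x, y).
Let v1 : grid a b := (x + 1, y).
Let v2 : grid a b := (x + 1, y + 1).
Let v3 : grid a b := (x, y + 1).

Lemma block22E : block22 x y = [set v0; v1; v2; v3]%SET.
Proof.
apply/setP => -[p q]; rewrite !inE /= /v0 /v1 /v2 /v3 !xpair_eqE.
by case: (p == x); case: (p == x + 1); case: (q == y); case: (q == y + 1).
Qed.

Lemma block22_uniq : uniq [:: v0; v1; v2; v3].
Proof.
rewrite /= !inE !xpair_eqE !eqxx ![x == _]eq_sym ![y == _]eq_sym !addr1_neq.
by rewrite /= ?andbF.
Qed.

Lemma block22_cycle : [&& e v0 v1, e v1 v2, e v2 v3 & e v3 v0].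
Proof.
apply/and4P; split; apply/grid_adjP => /=; rewrite ?addrK.
- by constructor 1.
- by constructor 3.
- by constructor 2.
- by constructor 4.
Qed.

Lemma grid_adj_diag (u v : grid a b) : u.1 != v.1 -> u.2 != v.2 -> ~~ e u v.
Proof.
by move=> h1 h2; apply/grid_adjP => -[] E; move: h1 h2; rewrite E /= eqxx.
Qed.

Lemma block22_diag : ~~ e v0 v2 /\ ~~ e v1 v3.
Proof. by split; apply: grid_adj_diag; rewrite /= ?addr1_neq // eq_sym addr1_neq. Qed.

(** Two of the four listed neighbours of a corner lie in the block. The other two may also coincide
    with block vertices on a narrow torus, so only an upper bound is claimed. *)
Lemma block22_deg v : v \in [set v0; v1; v2; v3]%SET ->
  (#|outer_nbrs e [set v0; v1; v2; v3]%SET v| <= 2)%N.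
Proof.
set B : {set grid a b} := [set v0; v1; v2; v3]%SET.
have sub2 (A : {set grid a b}) p q : (forall u, u \in A -> u = p \/ u = q) -> (#|A| <= 2)%N.
  move=> H; apply: (@leq_trans #|[set p; q]%SET|); last by rewrite cards2; case: eqP.
  by apply: subset_leq_card; apply/fintype.subsetP => u /H[]->; rewrite !inE eqxx ?orbT.
have nB u : u \in outer_nbrs e B v -> [/\ u != v0, u != v1, u != v2, u != v3 & e v u].
  by rewrite !inE !negb_or -!andbA => /and5P[-> -> -> -> ->].
rewrite !inE -!orbA => /or4P[] /eqP vE; rewrite {}vE in nB *.
- apply: (sub2 _ (x - 1, y) (x, y - 1)) => u /nB[u0 u1 u2 u3 /grid_adjP[] /= uE].
  by rewrite uE eqxx in u1. by left. by rewrite uE eqxx in u3. by right.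
- apply: (sub2 _ (x + 1 + 1, y) (x + 1, y - 1)) => u /nB[u0 u1 u2 u3 /grid_adjP[] /= uE].
  by left. by rewrite uE addrK eqxx in u0. by rewrite uE eqxx in u2. by right.
- apply: (sub2 _ (x + 1 + 1, y + 1) (x + 1, y + 1 + 1)) => u /nB[u0 u1 u2 u3 /grid_adjP[] /= uE].
  by left. by rewrite uE addrK eqxx in u3. by right. by rewrite uE addrK eqxx in u1.
- apply: (sub2 _ (x - 1, y + 1) (x, y + 1 + 1)) => u /nB[u0 u1 u2 u3 /grid_adjP[] /= uE].
  by rewrite uE eqxx in u2. by left. by right. by rewrite uE addrK eqxx in u0.
Qed.

Lemma block22_contracts (R : realType) : contracts (block_update R e (block22 x y)) (block22 x y).
Proof.
rewrite block22E; apply: block_contracts.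
- exact: block22_uniq.
- exact: grid_adj_sym.
- exact: block22_cycle.
- exact: grid_adj_irr.
- exact: block22_diag.
- exact: block22_deg.
Qed.
End Grid.

(** * Existence of a proper colouring *)

Section GridColouring.

(* A proper 3-colouring of the cycle; the grid is coloured by adding the colours of the two
   coordinates mod 3. *)
Definition cycle_colour (n i : nat) : nat := if i == n.-1 then 2%N else odd i.

Lemma cycle_colour_lt3 n i : (cycle_colour n i < 3)%N.
Proof. by rewrite /cycle_colour; case: ifP => // _; case: odd. Qed.

Lemma cycle_colour_neq n (p : 'Z_n) : (2 <= n)%N -> cycle_colour n (p + 1)%R != cycle_colour n p.
Proof.
case: n p => [|[|n]] // p _.
have -> : nat_of_ord (p + 1) = ((p + 1) %% n.+2)%N by rewrite /= modnDmr.
(* The last vertex, coloured 2, wraps around to 0 and is treated apart. *)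
have := ltn_ord p; rewrite [X in (_ < X)%N -> _]/= leq_eqVlt => /orP[/eqP[pn]|];
  rewrite /cycle_colour /=.
  by rewrite pn eqxx addn1 modnn.
rewrite ltnS => pn; rewrite modn_small ?addn1 // (ltn_eqF pn).
by case: ifP; [case: (odd p)|rewrite oddS; case: odd].
Qed.

(** A step along an edge changes exactly one summand, and does so modulo 3. Nonemptiness makes the
    uniform distribution a probability. *)
Lemma proper_colourings_neq0 a b : (2 <= a)%N -> (2 <= b)%N ->
  proper_colourings (@grid_adj a b) != finset.set0.
Proof.
move=> ha hb; apply/set0Pn.
pose k (u : grid a b) := ((cycle_colour a u.1 + cycle_colour b u.2) %% 3)%N.
have k7 u : (k u < 7)%N by apply: (@ltn_trans 3) => //; rewrite ltn_mod.
exists [ffun u => Ordinal (k7 u)]; rewrite inE.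
have k1 p q : k ((p + 1)%R, q) != k (p, q).
  change ((cycle_colour a (p + 1)%R + cycle_colour b q) %% 3 !=
          (cycle_colour a p + cycle_colour b q) %% 3)%N.
  by rewrite eqn_modDr 2?modn_small ?cycle_colour_lt3 // cycle_colour_neq.
have k2 p q : k (p, (q + 1)%R) != k (p, q).
  change ((cycle_colour a p + cycle_colour b (q + 1)%R) %% 3 !=
          (cycle_colour a p + cycle_colour b q) %% 3)%N.
  by rewrite eqn_modDl 2?modn_small ?cycle_colour_lt3 // cycle_colour_neq.
apply/forallP => u; apply/forallP => v; apply/implyP => /grid_adjP uv.
rewrite !ffunE -val_eqE; change (k u != k v); case: uv => ->.
- by rewrite eq_sym; exact: k1.
- by have := k1 (u.1 - 1) u.2; rewrite subrK.
- by rewrite eq_sym; exact: k2.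
- by have := k2 u.1 (u.2 - 1); rewrite subrK.
Qed.
End GridColouring.

Theorem theorem2 (R : realType) (a b : nat) (ha : (2 <= a)%N) (hb : (2 <= b)%N)
    (m : nat) (Theta : m.-tuple {set grid a b})
    (Theta_uniq : uniq Theta)
    (Theta_cover : min_block_cover [set B in Theta])
    (eps : R) (eps_gt0 : 0 < eps) (eps_lt1 : eps < 1) :
  (mixing_time (systematic_scan R (@grid_adj a b) Theta)
     (uniform_dist R (proper_colourings (@grid_adj a b))) eps
   <= (63 * ln ((a * b)%:R * eps^-1))%:E)%E.
Proof.
have [[blocks cov] _] := Theta_cover.
have n4 : 4 <= (a * b)%:R :> R by rewrite ler_nat (leq_mul ha hb).
have [t [t0 tL tE]] := decay_le n4 eps_gt0 eps_lt1.
apply: bigmax_le => [|s _]; first exact: leNye.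
apply: ereal_inf_le; exists (t%:R)%:E; last by rewrite lee_fin.
exists t => //; split => //; apply: le_trans tE.
have -> : (a * b)%N = #|{: grid a b}|.
  by rewrite card_prod !card_ord !Zp_cast.
apply: dTV_scan_le.
- exact: grid_adj_sym.
- exact: proper_colourings_neq0.
(* The blocks cover the grid, so one scan contracts the oscillation at every vertex. *)
have -> : [set: grid a b]%SET = (\bigcup_(B <- Theta) B)%SET.
  rewrite -cov /finset.cover.
  by rewrite finset.bigcup_seq; apply: eq_bigl => B; rewrite inE.
apply: scan_contracts => B BT.
have [|x [y ->]] := blocks B; first by rewrite inE.
exact: block22_contracts.
Qed.
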